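(* Let $G$ be a chordal graph with $n$ vertices and $k$ connected components. Then the symmetric function $(-1)^{n-k}M_G(\mathbf x)$ is $e$-positive, i.e., when it is expanded in the basis of elementary symmetric functions $\{e_\lambda(\mathbf x):\lambda\vdash n-k\}$, all coefficients are nonnegative.
   Context: All graphs are finite and simple. A graph is chordal if it has no induced cycle of length greater than $3$. A weak composition of $m\ge 0$ is an infinite sequence $\nu=(\nu(1),\nu(2),\dots)$ of nonnegative integers with sum $m$; $\mathrm{WComp}_m$ is the set of these. Weak compositions are added and compared ($\nu\ge\mu$) componentwise. An $\infty$-weighted partition of a finite set $S$ is a set $\boldsymbol\pi=\{B_1^{\nu_1},\dots,B_k^{\nu_k}\}$ where $\{B_1,\dots,B_k\}$ is a partition of $S$ (the underlying partition) and $\nu_i\in\mathrm{WComp}_{|B_i|-1}$ for all $i$. The poset $\Pi_S^\infty$ of all such has order $\{A_1^{\mu_1},\dots,A_j^{\mu_j}\}\le\{B_1^{\nu_1},\dots,B_k^{\nu_k}\}$ iff $\{A_1,\dots,A_j\}$ refines $\{B_1,\dots,B_k\}$ and, whenever $B_m=A_{i_1}\cup\dots\cup A_{i_l}$, one has $\nu_m\ge\mu_{i_1}+\dots+\mu_{i_l}$. For a graph $G=(V,E)$, $\Pi_G^\infty$ is the induced subposet of $\Pi_V^\infty$ of those $\boldsymbol\pi$ each of whose blocks induces a connected subgraph of $G$. Its minimum element $\hat 0$ has all blocks singletons of weight $(0,0,\dots)$; all closed intervals of $\Pi_G^\infty$ are finite. The Möbius symmetric function of $G$ in variables $\mathbf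 x=(x_1,x_2,\dots)$ is $$M_G(\mathbf x)=\sum_{\boldsymbol\pi}\mu_{\Pi_G^\infty}(\hat 0,\boldsymbol\pi)\,\mathbf x^{w(\boldsymbol\pi)},$$ the sum being over maximal elements $\boldsymbol\pi$ of $\Pi_G^\infty$, where $w(\boldsymbol\pi)$ is the sum of the weights of the blocks of $\boldsymbol\pi$ and $\mathbf x^\nu=x_1^{\nu(1)}x_2^{\nu(2)}\cdots$. It is a homogeneous symmetric function of degree $n-k$. Here $\mu_P$ denotes the Möbius function of a poset $P$. *)

(* Defs.v *)
From HB Require Import structures.
From mathcomp Require Import all_boot all_order all_algebra.
From mathcomp Require Import finmap multiset.
From mathcomp Require Import mathcomp_extra boolp classical_sets functions.
From mathcomp Require Import cardinality fsbigop.

Set Implicit Arguments.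
Unset Strict Implicit.
Unset Printing Implicit Defensive.

Import Order.TTheory GRing.Theory Num.Theory.

Local Open Scope classical_set_scope.
Local Open Scope ring_scope.

(* A weak composition is a finitely supported function [nat -> nat], i.e. a
   multiset over [nat], the entries being indexed from 0.  [size nu] is the sum
   of its entries, [msetD] is componentwise addition and [msubset] is the
   componentwise order. *)
Notation wcomp := ({mset nat}%mset).

HB.instance Definition _ (K : choiceType) :=
  Monoid.isComLaw.Build {mset K}%mset mset0 (@msetD K)
    (@msetDA K) (@msetDC K) (@mset0D K).

Lemma big_msetDE (I : Type) (r : seq I) (P : pred I) (F : I -> wcomp) i :
  (\big[msetD/mset0]_(j <- r | P j) F j) i = (\sum_(j <- r | P j) F j i)%N.
Proof.
apply: (big_morph (fun m : wcomp => m i)) => [m m'|]; last exact: mset0E.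
by rewrite msetE2.
Qed.

Lemma finite_msubset (m : wcomp) :
  finite_set [set u : wcomp | msubset u m].
Proof.
pose S := finsupp m.
pose f (g : {ffun S -> 'I_(size m).+1}) : wcomp :=
  [fsfun x : S => (g x : nat)]%fset.
apply: (@sub_finite_set _ _ (f @` [set: {ffun S -> 'I_(size m).+1}])).
  move=> u /= um; have um' := msubsetP um.
  exists [ffun x : S => inord (u (val x))] => //.
  apply/fsfunP => i; rewrite fsfun_ffun; case: insubP => [x xS xi|] /=.
    rewrite -xi ffunE inordK // ltnS; apply: leq_trans (um' _) _.
    by rewrite size_mset (big_fsetD1 (val x)) ?leq_addr //= (valP x).
  rewrite memNfinsupp => /eqP mi0.
  by have := um' i; rewrite mi0 leqn0 => /eqP.
by apply: finite_image; apply: finite_finset.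
Qed.

Section Mobius.
Context {disp : Order.disp_t} {T : porderType disp}.
Implicit Types (x y z : T) (n : nat).

(* The recursion
     mu(x, x) = 1,   mu(x, y) = - \sum_(x <= z < y) mu(x, z)  if x < y,
   cut off after n steps; the cardinality of the interval [x, y] is enough
   steps, see [mobius_lt]. *)
Fixpoint mobius_rec n x y : int :=
  if x == y then 1 else
  if n is n'.+1 then
    - \sum_(z \in [set z : T | (x <= z < y)%O]) mobius_rec n' x z
  else 0.

Definition mobius x y : int :=
  if (x <= y)%O then
    mobius_rec #|` fset_set [set z : T | (x <= z <= y)%O]|%fset x y
  else 0.

Definition maximal x := forall y, (x <= y)%O -> y = x.

Let itv x y := [set z : T | (x <= z <= y)%O].

Lemma mobius_xx x : mobius x x = 1.
Proof. by rewrite /mobius lexx; case: #|` _|%fset => [|n] /=; rewrite eqxx. Qed.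

Let card_itv_lt x y z : finite_set (itv x y) -> (x <= z)%O -> (z < y)%O ->
  (#|` fset_set (itv x z)| < #|` fset_set (itv x y)|)%fset%N.
Proof.
move=> fin xz zy.
have sub : itv x z `<=` itv x y.
  by move=> t; rewrite /itv /= => /andP[-> /le_trans->] //; apply: ltW.
have fin' := sub_finite_set sub fin.
apply: fproper_ltn_card; rewrite fproperEneq; apply/andP; split; last first.
  by apply/fsubsetP => t; rewrite !in_fset_set // => /set_mem/sub/mem_set.
apply/eqP => /fsetP/(_ y); rewrite !in_fset_set //.
have -> : y \in itv x y by apply/mem_set; rewrite /itv /= lexx (le_trans xz (ltW zy)).
by move/set_mem; rewrite /itv /= => /andP[_ /(lt_le_trans zy)]; rewrite ltxx.
Qed.

Let mobius_rec_stable n m x y : finite_set (itv x y) -> (x <= y)%O ->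
  (#|` fset_set (itv x y)| <= n)%fset%N ->
  (#|` fset_set (itv x y)| <= m)%fset%N ->
  mobius_rec n x y = mobius_rec m x y.
Proof.
elim: n m y => [|n IHn] [|m] y fin xy //= le_n le_m; case: eqVneq => // x_neq_y.
- by have := leq_trans (card_itv_lt fin (lexx x) _) le_n;
    rewrite lt_neqAle x_neq_y xy ltn0 => /(_ isT).
- by have := leq_trans (card_itv_lt fin (lexx x) _) le_m;
    rewrite lt_neqAle x_neq_y xy ltn0 => /(_ isT).
congr (- _); apply: eq_fsbigr => z /set_mem /= /andP[xz zy].
have lt_card := card_itv_lt fin xz zy.
apply: IHn => //; try by rewrite -ltnS (leq_trans lt_card).
apply: sub_finite_set fin => t; rewrite /itv /= => /andP[-> /le_trans->] //.
exact: ltW.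
Qed.

Lemma mobius_lt x y :
  finite_set [set z : T | (x <= z <= y)%O] -> (x < y)%O ->
  mobius x y = - \sum_(z \in [set z : T | (x <= z < y)%O]) mobius x z.
Proof.
move=> fin xy; rewrite {1}/mobius (ltW xy).
have := card_itv_lt fin (lexx x) xy.
rewrite -/(itv x y); case def_n: #|` fset_set (itv x y)|%fset => [|n] //= _.
rewrite lt_eqF //; congr (- _); apply: eq_fsbigr => z /set_mem /= /andP[xz zy]; rewrite /mobius xz.
have lt_card := card_itv_lt fin xz zy.
apply: mobius_rec_stable => //; last by rewrite -ltnS -def_n.
apply: sub_finite_set fin => t; rewrite /itv /= => /andP[-> /le_trans->] //.
exact: ltW.
Qed.

End Mobius.

(* The block B of weight nu is the pair (B, nu). *)
Notation wblock V := ({set V} * wcomp)%type.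
Notation bset p := (@fst {set _} wcomp p).
Notation bwt p := (@snd {set _} wcomp p).

Lemma uniq_map_inj (T U : eqType) (f : T -> U) (s : seq T) :
  uniq (map f s) -> {in s &, injective f}.
Proof.
elim: s => //= x s IH /andP[fx us] y z; rewrite !inE.
case/predU1P=> [->|ys] /predU1P[->|zs] // eq_f; last exact: IH.
- by case/negP: fx; rewrite eq_f map_f.
- by case/negP: fx; rewrite -eq_f map_f.
Qed.

Section WeightedPartitions.
Context {V : finType}.

Definition is_wpartition (pi : {fset wblock V}) : bool :=
  let underlying := [seq bset p | p <- pi] in
  [&& uniq underlying,
      finset.partition [set:: underlying] [set: V]%SET
    & all (fun p => size (bwt p) == #|bset p|.-1) pi].

Record wpartition := WPartition {
  wblocks :> {fset wblock V};
  _ : is_wpartition wblocks }.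

HB.instance Definition _ := [isSub for wblocks].
HB.instance Definition _ := [Choice of wpartition by <:].

Implicit Types pi rho sigma : wpartition.

Definition wpartition_le pi rho : bool :=
  all (fun p => has (fun q => bset p \subset bset q) rho) pi &&
  all (fun q => msubset (\big[msetD/mset0]_(p <- pi | bset p \subset bset q) bwt p)
                     (bwt q)) rho.

Definition weight pi : wcomp := \big[msetD/mset0]_(p <- pi) bwt p.

Lemma wblock_neq0 pi p : p \in wblocks pi -> bset p != finset.set0.
Proof.
case: pi => pi /= /and3P[_ /and3P[_ _ pi0] _] p_pi.
by apply: contraNneq pi0 => <-; rewrite inE; apply: map_f.
Qed.

Lemma wblock_exists pi (v : V) : exists2 p, p \in wblocks pi & v \in bset p.
Proof.
case: pi => pi /= /and3P[_ /and3P[/eqP cov _ _] _].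
have := finset.in_setT v; rewrite -cov => /bigcupP[B]; rewrite inE.
by case/mapP => p p_pi -> vp; exists p.
Qed.

Lemma wblock_inj pi p q (v : V) : p \in wblocks pi -> q \in wblocks pi ->
  v \in bset p -> v \in bset q -> p = q.
Proof.
case: pi => pi /= /and3P[uniq_pi /and3P[_ /finset.trivIsetP triv _] _] p_pi q_pi vp vq.
have : bset p = bset q.
  apply/eqP/negPn/negP => neq_pq.
  have := triv (bset p) (bset q); rewrite !inE !map_f // => /(_ isT isT neq_pq).
  by move/disjoint_setI0/setP/(_ v); rewrite !inE vp vq.
move=> eq_pq; have : {in pi &, injective (@fst {set V} wcomp)}.
  exact: uniq_map_inj.
exact.
Qed.

Lemma wpartition_leP pi rho : reflect
  ((forall p, p \in wblocks pi ->
      exists2 q, q \in wblocks rho & bset p \subset bset q) /\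
   (forall q i, q \in wblocks rho ->
      \sum_(p <- pi | bset p \subset bset q) (bwt p) i <= (bwt q) i)%N)
  (wpartition_le pi rho).
Proof.
apply: (iffP andP) => [[/allP le1 le2]|[le1 le2]]; split.
- by move=> p /le1 /hasP.
- move=> q i q_rho; have /msubsetP/(_ i) := (allP le2) q q_rho.
  by rewrite big_msetDE.
- by apply/allP => p /le1 [q q_rho pq]; apply/hasP; exists q.
- apply/allP => q q_rho; apply/msubsetP => i; rewrite big_msetDE.
  exact: le2.
Qed.

Lemma wblock_sub_eq pi p q : p \in wblocks pi -> q \in wblocks pi ->
  bset p \subset bset q -> p = q.
Proof.
move=> p_pi q_pi /fintype.subsetP pq; have /finset.set0Pn[v vp] := wblock_neq0 p_pi.
by apply: (wblock_inj p_pi q_pi vp); apply: pq.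
Qed.

Lemma wpartition_le_refl : reflexive wpartition_le.
Proof.
move=> pi; apply/wpartition_leP; split=> [p p_pi|q i q_pi]; first by exists p.
rewrite (big_rem q) //= subxx big_seq_cond big1 ?addn0 // => p.
case/andP=> p_pi pq; have := wblock_sub_eq (mem_rem p_pi) q_pi pq => p_q.
by rewrite p_q mem_rem_uniqF ?fset_uniq in p_pi.
Qed.

Lemma wpartition_le_block pi rho p q : wpartition_le pi rho ->
  p \in wblocks pi -> q \in wblocks rho -> bset p \subset bset q ->
  msubset (bwt p) (bwt q).
Proof.
case/wpartition_leP=> _ le2 p_pi q_rho pq; apply/msubsetP => i.
by apply: leq_trans (le2 q i q_rho); rewrite (big_rem p) //= pq leq_addr.
Qed.

Lemma wpartition_le_anti : antisymmetric wpartition_le.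
Proof.
have sub pi rho : wpartition_le pi rho -> wpartition_le rho pi ->
    {subset wblocks pi <= wblocks rho}.
  move=> le1 le2 p p_pi.
  have /wpartition_leP[/(_ p p_pi)[q q_rho pq] _] := le1.
  have /wpartition_leP[/(_ q q_rho)[p' p'_pi qp'] _] := le2.
  have def_p' := wblock_sub_eq p_pi p'_pi (fintype.subset_trans pq qp').
  rewrite -def_p' in qp'; suff -> : p = q by [].
  have eq1 : bset p = bset q by apply/eqP; rewrite finset.eqEsubset pq.
  have eq2 : bwt p = bwt q.
    apply/eqP; rewrite eqEmsubset (wpartition_le_block le1) //.
    exact: (wpartition_le_block le2).
  by move: eq1 eq2; case: (p) (q) => [? ?] [? ?] /= -> ->.
move=> pi rho /andP[le1 le2]; apply/val_inj/fsetP => p.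
by apply/idP/idP; apply: sub.
Qed.

Lemma wpartition_le_trans : transitive wpartition_le.
Proof.
move=> rho pi sigma le1 le2.
have /wpartition_leP[pi_rho w1] := le1.
have /wpartition_leP[rho_sigma w2] := le2.
apply/wpartition_leP; split=> [p /pi_rho[q /rho_sigma[r r_sigma qr] pq]|r i rs].
  by exists r => //; apply: fintype.subset_trans qr.
apply: leq_trans (w2 r i rs).
apply: (@leq_trans (\sum_(q <- rho | bset q \subset bset r)
   \sum_(p <- pi | bset p \subset bset q) (bwt p) i)); last first.
  by rewrite !(big_seq_cond (fun q => bset q \subset _)) leq_sum // => q /andP[qr _];
    apply: w1.
rewrite (exchange_big_dep predT) //=.
rewrite [leqRHS](bigID (fun p => bset p \subset bset r)) /=.
apply: leq_trans (leq_addr _ _); rewrite !(big_seq_cond (fun p => bset p \subset _)).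
apply: leq_sum => p /andP[p_pi pr].
have [q q_rho pq] := pi_rho p p_pi.
rewrite (big_rem q) //= pq andbT; case: ifPn => [_|]; first exact: leq_addr.
case/negP; have [r' r's qr'] := rho_sigma q q_rho.
have /finset.set0Pn[v vp] := wblock_neq0 p_pi.
suff -> : r = r' by [].
apply: (wblock_inj rs r's (v := v)); first exact: (fintype.subsetP pr).
exact/(fintype.subsetP qr')/(fintype.subsetP pq).
Qed.

HB.instance Definition _ := Order.Le_isPOrder.Build
  (Order.Disp tt tt) wpartition
  wpartition_le_refl wpartition_le_anti wpartition_le_trans.

Lemma finite_wpartition_weight (m : wcomp) :
  finite_set [set pi : wpartition | msubset (weight pi) m].
Proof.
have finD := finite_msubset m.
pose X := ([fset B in {: {set V}}] `*` fset_set [set u : wcomp | msubset u m])%fset.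
have finX : finite_set (wblocks @^-1` [set` fpowerset X]).
  by apply: finite_preimage => [pi rho _ _|]; [apply: val_inj|apply: finite_fset].
apply: sub_finite_set finX => pi /= le_m; rewrite fpowersetE.
apply/fsubsetP => p p_pi; rewrite in_fsetM in_fset_set //.
apply/andP; split; first by rewrite in_fset.
apply/mem_set; rewrite /=; apply: msubset_trans le_m; apply/msubsetP => i.
by rewrite big_msetDE (big_rem p) //= leq_addr.
Qed.

Lemma weight_le pi rho : wpartition_le pi rho -> msubset (weight pi) (weight rho).
Proof.
move=> le1; have /wpartition_leP[pi_rho w1] := le1.
apply/msubsetP => i; rewrite !big_msetDE.
apply: (@leq_trans (\sum_(q <- rho)
   \sum_(p <- pi | bset p \subset bset q) (bwt p) i)); last first.
  by rewrite big_seq [leqRHS]big_seq leq_sum // => q q_rho; apply: w1.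
rewrite (exchange_big_dep predT) //= big_seq [leqRHS]big_seq.
apply: leq_sum => p p_pi; have [q q_rho pq] := pi_rho p p_pi.
by rewrite (big_rem q) //= pq leq_addr.
Qed.

(* Closed intervals are finite. *)
Lemma finite_wpartition_itv pi rho :
  finite_set [set sigma : wpartition | (pi <= sigma <= rho)%O].
Proof.
apply: sub_finite_set (finite_wpartition_weight (weight rho)) => sigma.
by case/andP => _; apply: weight_le.
Qed.

End WeightedPartitions.

Section Graph.
Context {V : finType}.

(* A duplicate-free c spans an induced cycle when its only edges are those
   between cyclically consecutive entries. *)
Definition chordal (E : rel V) : Prop :=
  forall c : seq V, uniq c -> (3 < size c)%N ->
  ~ {in c &, forall x y, E x y = (next c x == y) || (next c y == x)}.

Definition induces_connected (E : rel V) (B : {set V}) : bool :=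
  [forall x in B, forall y in B,
    connect [rel u v | [&& u \in B, v \in B & E u v]] x y].

Record gpartition (E : rel V) := GPartition {
  gpartition_val :> wpartition;
  _ : all (fun p => induces_connected E (bset p)) gpartition_val }.
End Graph.
Arguments wpartition : clear implicits.

Section GraphPoset.
Context {V : finType} (E : rel V).

HB.instance Definition _ := [isSub for @gpartition_val V E].
HB.instance Definition _ := [Choice of gpartition E by <:].
HB.instance Definition _ := 
  [SubChoice_isSubPOrder of gpartition E by <: with Order.Disp tt tt].

Definition bottom_blocks : {fset wblock V} :=
  [fset ([set v]%SET, mset0) | v in {: V}]%fset.

Lemma in_bottom_blocks p : p \in bottom_blocks ->
  exists v : V, p = ([set v]%SET, mset0).
Proof. by case/imfsetP => v _ ->; exists v. Qed.

Lemma bottom_blocksE (v : V) : ([set v]%SET, mset0 : wcomp) \in bottom_blocks.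
Proof. by apply/imfsetP; exists v. Qed.

Lemma bottom_is_wpartition : is_wpartition bottom_blocks.
Proof.
apply/and3P; split.
- rewrite map_inj_in_uniq ?fset_uniq // => p q.
  by move=> /in_bottom_blocks[u ->] /in_bottom_blocks[v ->] /= ->.
- apply/and3P; split.
  + apply/eqP/setP => v; rewrite finset.in_setT; apply/bigcupP.
    exists [set v]%SET; rewrite ?finset.inE //.
    by apply/mapP; exists ([set v]%SET, mset0) => //; apply: bottom_blocksE.
  + apply/finset.trivIsetP => A B; rewrite !finset.inE.
    case/mapP => p /in_bottom_blocks[u ->] -> /mapP[q /in_bottom_blocks[v ->] ->].
    by rewrite /= => neq_uv; rewrite disjoints1 finset.inE; apply: contraNneq neq_uv => ->.
  + rewrite finset.inE; apply/mapP => -[p /in_bottom_blocks[v ->]] /= /setP/(_ v).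
    by rewrite !finset.inE eqxx.
- apply/allP => p /in_bottom_blocks[v ->] /=; by rewrite size_mset0 cards1.
Qed.

Lemma bottom_connected : all (fun p => induces_connected E (bset p))
  (WPartition bottom_is_wpartition).
Proof.
apply/allP => p /in_bottom_blocks[v ->] /=.
by apply/forall_inP => x /set1P->; apply/forall_inP => y /set1P->; apply: connect0.
Qed.

Definition gbottom : gpartition E := GPartition bottom_connected.

Lemma gbottom_le (pi : gpartition E) : (gbottom <= pi)%O.
Proof.
apply/wpartition_leP; split=> [p /in_bottom_blocks[v ->] /=|q i q_pi].
  by have [q q_pi vq] := wblock_exists pi v; exists q; rewrite ?finset.sub1set.
rewrite big_seq_cond big1 // => p /andP[/in_bottom_blocks[v ->] _] /=.
exact: mset0E.
Qed.

HB.instance Definition _ := Order.hasBottom.Build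
  (Order.Disp tt tt) (gpartition E) gbottom_le.

Lemma finite_gpartition_itv (pi rho : gpartition E) :
  finite_set [set sigma : gpartition E | (pi <= sigma <= rho)%O].
Proof.
apply: (@finite_preimage _ _
    [set sigma : wpartition V | (val pi <= sigma <= val rho)%O] val).
  by apply: in2W; apply: val_inj.
exact: finite_wpartition_itv.
Qed.

Lemma finite_gpartition_weight (m : wcomp) :
  finite_set [set pi : gpartition E | weight pi = m].
Proof.
apply: (@sub_finite_set _ _
    (val @^-1` [set pi : wpartition V | msubset (weight pi) m])).
  by move=> pi /= ->; apply: msubset_refl.
apply: finite_preimage (finite_wpartition_weight m).
by apply: in2W; apply: val_inj.
Qed.

End GraphPoset.

(* A formal power series with integer coefficients in countably many variables,
   given by the coefficient of each monomial x^nu. *)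
Definition fps := wcomp -> int.

Definition fps1 : fps := fun nu => (nu == mset0)%:R.

Definition fps_mul (f g : fps) : fps := fun nu =>
  \sum_(ab \in [set ab : wcomp * wcomp | msetD ab.1 ab.2 = nu]) f ab.1 * g ab.2.

Lemma finite_fps_mul nu :
  finite_set [set ab : wcomp * wcomp | msetD ab.1 ab.2 = nu].
Proof.
have fin := finite_msubset nu; apply: sub_finite_set (finite_setX fin fin).
by move=> [a b] /= <-; split; apply/msubsetP => i; rewrite msetE2 ?leq_addr ?leq_addl.
Qed.

(* The elementary symmetric function e_k is the sum of all squarefree monomials
   of degree k. *)
Definition elem_sym (k : nat) : fps := fun nu =>
  ((size nu == k) && all (fun i => nu i <= 1)%N (finsupp nu))%:R.

Definition elem_sym_part (la : seq nat) : fps :=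
  foldr (fun k f => fps_mul (elem_sym k) f) fps1 la.

Definition is_part (d : nat) (la : seq nat) : bool :=
  [&& sorted geq la, 0%N \notin la & sumn la == d].

Lemma finite_is_part d : finite_set [set la | is_part d la].
Proof.
pose X := [set` [seq map val (tval t) | s <- iota 0 d.+1,
                            t <- enum {: s.-tuple 'I_d.+1}]].
apply: (@sub_finite_set _ _ X); last exact: finite_seq.
move=> la /= /and3P[_ la0 /eqP sum_la].
have le_d k : k \in la -> (k <= d)%N.
  by move=> /perm_to_rem/perm_sumn; rewrite sum_la /= => ->; apply: leq_addr.
have size_d : (size la <= d)%N.
  rewrite -sum_la {le_d sum_la}; elim: la la0 => //= k la IH.
  rewrite inE negb_or eq_sym -lt0n => /andP[k0 /IH le1].
  by rewrite -add1n leq_add.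
apply/allpairsPdep; exists (size la), (map_tuple (fun k => inord k) (in_tuple la)).
rewrite mem_iota ltnS size_d mem_enum; split=> //=.
rewrite -map_comp -[LHS]map_id; apply/eq_in_map => k k_la /=.
by rewrite inordK // ltnS le_d.
Qed.

(* The e_la, for la a partition of d, form a basis, so the coefficients c la are
   those of the expansion of f. *)
Definition e_positive (d : nat) (f : fps) : Prop :=
  exists2 c : seq nat -> int,
    (forall la, is_part d la -> 0 <= c la) &
    forall nu, f nu = \sum_(la \in [set la | is_part d la])
                        c la * elem_sym_part la nu.

(* Each coefficient is a finite sum, by [finite_gpartition_weight]. *)
Definition mobius_sym {V : finType} (E : rel V) : fps := fun nu =>
  \sum_(pi \in [set pi : gpartition E | maximal pi])
    mobius \bot%O pi * (weight pi == nu)%:R.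

(* Main.v *)
(** The Moebius function of an interval is multiplicative over blocks, and summing
    it to 0 over the interval below a connected block says that the series b(B)
    (the signless Moebius symmetric function of the graph induced on B) satisfy
      sum over connected partitions P of B of
        (-1)^(|P|-1) h_(|P|-1) * prod_(C in P) b(C) = 0   when |B| > 1,
    since the weight left over is any weak composition of |P|-1.

    A perfect elimination order solves this recursion positively.  Let r be the
    least vertex of B and call a sequence D_1, ..., D_m of disjoint connected sets
    with union B minus r admissible when r together with every prefix is connected.
    Then b(B) is the sum over admissible sequences of prod b(D_i) times the product
    of e_l over the lengths l of the maximal runs along which min D_i increases.
    Indeed, listing a connected partition by increasing minima and expanding the
    block of r into a sequence, one gets an admissible sequence with i <= s final
    blocks marked, s being the length of its last run: here chordality is used,
    as in a connected set every vertex but the first has an earlier neighbour, so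
    that the prefixes are connected.  The sum over i is a multiple of
    sum_i (-1)^i h_i e_(s-i) = 0. *)

Require Import Defs.
From HB Require Import structures.
From mathcomp Require Import finmap multiset boolp classical_sets cardinality fsbigop.
From mathcomp Require Import all_boot all_order all_algebra.
From mathcomp Require Import zify.
Set Implicit Arguments.
Unset Strict Implicit.
Unset Printing Implicit Defensive.
Import Order.TTheory GRing.Theory.
Local Open Scope ring_scope.

(** * The ring of formal power series *)

Definition pser := wcomp -> int.

HB.instance Definition _ := gen_eqMixin pser.
HB.instance Definition _ := gen_choiceMixin pser.

Section PserZmod.
Let add (f g : pser) : pser := fun nu => f nu + g nu.
Let opp (f : pser) : pser := fun nu => - f nu.
Let zero : pser := fun=> 0.

Fact pser_addA : associative add.
Proof. by move=> f g h; apply/funext => nu; apply: addrA. Qed.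
Fact pser_addC : commutative add.
Proof. by move=> f g; apply/funext => nu; apply: addrC. Qed.
Fact pser_add0 : left_id zero add.
Proof. by move=> f; apply/funext => nu; apply: add0r. Qed.
Fact pser_addN : left_inverse zero opp add.
Proof. by move=> f; apply/funext => nu; apply: addNr. Qed.

HB.instance Definition _ :=
  GRing.isZmodule.Build pser pser_addA pser_addC pser_add0 pser_addN.
End PserZmod.

Lemma pserD (f g : pser) nu : (f + g) nu = f nu + g nu. Proof. by []. Qed.
Lemma pserN (f : pser) nu : (- f) nu = - f nu. Proof. by []. Qed.
Lemma pser0 nu : (0 : pser) nu = 0. Proof. by []. Qed.

Lemma pser_sum (I : Type) (r : seq I) (P : pred I) (F : I -> pser) nu :
  (\sum_(i <- r | P i) F i) nu = \sum_(i <- r | P i) F i nu.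
Proof. exact: (big_morph (fun f : pser => f nu)). Qed.

Definition subwc (nu : wcomp) : seq wcomp :=
  fset_set [set u : wcomp | msubset u nu]%classic.

Lemma mem_subwc nu u : (u \in subwc nu) = msubset u nu.
Proof.
rewrite /subwc in_fset_set; last exact: finite_msubset.
by apply/idP/idP => [/set_mem|/mem_set].
Qed.

Lemma subwc_uniq nu : uniq (subwc nu). Proof. exact: fset_uniq. Qed.

Lemma msubset_addl (a b : wcomp) : msubset a (msetD a b).
Proof. by apply/msubsetP => i; rewrite msetE2 leq_addr. Qed.

Lemma msubset_addr (a b : wcomp) : msubset b (msetD a b).
Proof. by rewrite msetDC msubset_addl. Qed.

(** Both factors range over the same list [subwc nu] for every [d] below [nu], so that a product
    inside a product can be summed over one index set. *)
Lemma fps_mul_wide (f g : pser) nu d : msubset d nu -> fps_mul f g d =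
  \sum_(a <- subwc nu) \sum_(b <- subwc nu) (msetD a b == d)%:R * (f a * g b).
Proof.
move=> dnu; rewrite /fps_mul (fsbig_fwiden
  [seq (a, b) | a <- subwc nu, b <- [seq b <- subwc nu | msetD a b == d]]).
- rewrite big_allpairs_dep; apply: eq_bigr => a _; rewrite big_filter big_mkcond.
  by apply: eq_bigr => b _; case: eqP; rewrite ?mul1r ?mul0r.
- move=> [a b] /= ab; apply/allpairsPdep; exists a, b; split=> //.
    by rewrite mem_subwc (msubset_trans _ dnu) // -ab msubset_addl.
  by rewrite mem_filter ab eqxx mem_subwc (msubset_trans _ dnu) // -ab msubset_addr.
- apply: allpairs_uniq_dep => [|a _|]; rewrite ?filter_uniq ?subwc_uniq //.
  by move=> [a b] [a' b'] _ _ /= [-> ->].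
- move=> [a b] /= [/allpairsPdep[a' [b' [_ + [-> ->]]]]].
  by rewrite mem_filter => /andP[/eqP-> _] [].
Qed.

Lemma fps_mulE (f g : pser) nu : fps_mul f g nu =
  \sum_(a <- subwc nu) \sum_(b <- subwc nu | msetD a b == nu) f a * g b.
Proof.
rewrite (fps_mul_wide _ _ (msubset_refl nu)); apply: eq_bigr => a _.
rewrite [RHS]big_mkcond; apply: eq_bigr => b _.
by case: eqP; rewrite ?mul1r ?mul0r.
Qed.

Lemma fps_mulC : commutative (fps_mul : pser -> pser -> pser).
Proof.
move=> f g; apply/funext => nu; rewrite !(fps_mul_wide _ _ (msubset_refl nu)).
rewrite exchange_big; apply: eq_bigr => a _; apply: eq_bigr => b _.
by rewrite msetDC [f _ * _]mulrC.
Qed.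

(** Three independent summation variables give a form symmetric in the factors, from which
    associativity follows by commutativity. *)
Lemma fps_mul3 (f g h : pser) nu : fps_mul (fps_mul f g) h nu =
  \sum_(a <- subwc nu) \sum_(b <- subwc nu) \sum_(c <- subwc nu)
    (msetD (msetD a b) c == nu)%:R * (f a * g b * h c).
Proof.
rewrite (fps_mul_wide _ _ (msubset_refl nu)).
under eq_big_seq => d.
  rewrite mem_subwc => dnu.
  under eq_bigr => c _.
    rewrite (fps_mul_wide _ _ dnu) mulr_suml mulr_sumr.
    under eq_bigr => a _ do rewrite mulr_suml mulr_sumr.
    over.
  rewrite exchange_big /=.
  under eq_bigr => a _ do rewrite exchange_big /=.
  over.
rewrite exchange_big /=; apply: eq_bigr => a _.
rewrite exchange_big /=; apply: eq_bigr => b _.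
rewrite exchange_big /=; apply: eq_bigr => c _.
(* The intermediate exponent [d] must be [msetD a b], which is in the range of summation exactly
   when it lies below [nu]. *)
rewrite [in RHS]mulrC; have [dnu|dnu] := boolP (msubset (msetD a b) nu).
  rewrite (bigD1_seq (msetD a b)) ?mem_subwc ?subwc_uniq //= eqxx mul1r.
  rewrite big1 ?addr0 => [|d]; first by rewrite mulrC.
  by rewrite eq_sym => /negPf->; rewrite !mul0r mulr0.
rewrite big1_seq => [|d /andP[_]].
  case: eqP; rewrite ?mulr0 // => e; case/negP: dnu; by rewrite -e msubset_addl.
rewrite mem_subwc => dn; case: (msetD a b =P d) => [e|_]; last by rewrite !mul0r mulr0.
by rewrite e dn in dnu.
Qed.

Lemma fps_mulA : associative (fps_mul : pser -> pser -> pser).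
Proof.
move=> f g h; apply/funext => nu; rewrite fps_mulC !fps_mul3.
under eq_bigr => a _ do rewrite exchange_big /=.
rewrite exchange_big /=; apply: eq_bigr => a _; apply: eq_bigr => b _; apply: eq_bigr => c _.
by rewrite msetDC msetDA; congr (_ * _); rewrite mulrC mulrA.
Qed.

Lemma fps_mul1 : left_id (fps1 : pser) fps_mul.
Proof.
move=> f; apply/funext => nu; rewrite (fps_mul_wide _ _ (msubset_refl nu)).
have s0 : mset0 \in subwc nu by rewrite mem_subwc msub0set.
have snu : nu \in subwc nu by rewrite mem_subwc msubset_refl.
rewrite (bigD1_seq mset0) ?subwc_uniq //= [X in _ + X]big1 => [|a a0].
  rewrite addr0 (bigD1_seq nu) ?subwc_uniq //= big1 => [|b b0].
    by rewrite mset0D eqxx /fps1 eqxx !mul1r addr0.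
  by rewrite mset0D (negPf b0) mul0r.
by rewrite big1 // => b _; rewrite /fps1 (negPf a0) mul0r mulr0.
Qed.

Lemma fps_mulDl : left_distributive (fps_mul : pser -> pser -> pser) +%R.
Proof.
move=> f g h; apply/funext => nu; rewrite pserD !fps_mulE -big_split /=.
apply: eq_bigr => a _; rewrite -big_split /=; apply: eq_bigr => b _.
by rewrite pserD mulrDl.
Qed.

Fact fps1_neq0 : (fps1 : pser) != 0.
Proof. by apply/eqP => /(congr1 (@^~ mset0)); rewrite /fps1 eqxx. Qed.

HB.instance Definition _ := GRing.Zmodule_isComNzRing.Build pser
  fps_mulA fps_mulC fps_mul1 fps_mulDl fps1_neq0.

Lemma pser1E nu : (1 : pser) nu = (nu == mset0)%:R. Proof. by []. Qed.

(** The second exponent is forced to be the complement of the first in [nu], which leaves a single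
    sum. *)
Lemma pserME (f g : pser) nu : (f * g) nu =
  \sum_(a <- subwc nu) f a * g (msetB nu a).
Proof.
rewrite -[(f * g) nu]/(fps_mul f g nu) fps_mulE; apply: eq_big_seq => a.
rewrite mem_subwc => anu; rewrite -big_filter (perm_big [:: msetB nu a]) ?big_seq1 //.
apply: uniq_perm; rewrite ?filter_uniq ?subwc_uniq // => b.
rewrite mem_filter mem_subwc inE; apply/andP/eqP => [[/eqP <- _]|->].
  by rewrite msetDKB.
split; first by rewrite msetBDKC.
by apply/msubsetP => i; rewrite msetE2 leq_subr.
Qed.

(** * Elementary and complete homogeneous symmetric functions *)

Notation elsym k := (elem_sym k : pser).
Definition hsym (k : nat) : pser := fun nu => (size nu == k)%:R.

Lemma size_msetD (a b : wcomp) : size (msetD a b) = (size a + size b)%N.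
Proof.
have -> : msetD a b = seq_mset (a ++ b).
  apply/msetP => i; rewrite msetE2 mset_seqE count_cat.
  by congr (_ + _)%N; rewrite count_mem_mset.
by rewrite (perm_size (perm_eq_seq_mset _)) size_cat.
Qed.

Lemma size_msetB (a nu : wcomp) : msubset a nu ->
  size (msetB nu a) = (size nu - size a)%N.
Proof. by move=> anu; rewrite -{2}(msetBDKC anu) size_msetD addKn. Qed.

Lemma size_msubset (a nu : wcomp) : msubset a nu -> (size a <= size nu)%N.
Proof. by move=> anu; rewrite -(msetBDKC anu) size_msetD leq_addr. Qed.

Lemma msubset_size_eq (a b : wcomp) : msubset a b -> size a = size b -> a = b.
Proof.
move=> ab e; rewrite -(msetBDKC ab).
suff -> : msetB b a = mset0 by rewrite msetD0.
by apply/eqP; rewrite -size_mset_eq0 size_msetB // e subnn.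
Qed.

Lemma size_big_msetD (I : Type) (r : seq I) (F : I -> wcomp) :
  size (\big[msetD/mset0]_(i <- r) F i) = (\sum_(i <- r) size (F i))%N.
Proof.
by apply: (big_morph (fun m : wcomp => size m)) => [m m'|]; rewrite ?size_msetD ?size_mset0.
Qed.

Definition homog (d : nat) (f : pser) := forall nu, f nu != 0 -> size nu = d.

Lemma homog1 : homog 0 1.
Proof.
move=> nu; rewrite pser1E; case: (nu =P mset0) => [->|]; last by rewrite eqxx.
by rewrite size_mset0.
Qed.

Lemma homogM d d' f g : homog d f -> homog d' g -> homog (d + d') (f * g).
Proof.
move=> hf hg nu; rewrite pserME => nz.
have /hasP[a] : has (fun a => (f a != 0) && (g (msetB nu a) != 0)) (subwc nu).
  apply: contraNT nz => /hasPn all0; rewrite big1_seq // => a /andP[_ /all0].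
  by rewrite negb_and !negbK => /orP[]/eqP->; rewrite ?mul0r ?mulr0.
rewrite mem_subwc => anu /andP[/hf <- /hg <-].
by rewrite -size_msetD msetBDKC.
Qed.

Lemma homog_prod (I : eqType) (r : seq I) (d : I -> nat) (F : I -> pser) :
  {in r, forall i, homog (d i) (F i)} ->
  homog (\sum_(i <- r) d i) (\prod_(i <- r) F i).
Proof.
move=> hF; rewrite big_seq [in X in homog _ X]big_seq.
by elim/big_ind2: _ => //; [apply: homog1|move=> d1 f1 d2 f2; apply: homogM].
Qed.

Lemma elem_sym_homog k : homog k (elsym k).
Proof. by move=> nu; rewrite /elem_sym; case: (size nu =P k) => // _; rewrite eqxx. Qed.

Lemma elem_sym0 : elsym 0 = 1.
Proof.
apply/funext => nu; rewrite pser1E /elem_sym size_mset_eq0.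
case: eqP => // -> /=.
suff -> : all (fun i => (mset0 i <= 1)%N) (finsupp (mset0 : wcomp)) by [].
by apply/allP => i _; rewrite mset0E.
Qed.

Section SquarefreeToggle.
Variables (nu : wcomp) (x : nat).
Hypothesis x_nu : x \in nu.

Let sqfree (a : wcomp) := all (fun i => a i <= 1)%N (finsupp a).

Let sqfreeP (a : wcomp) : reflect (forall i, (a i <= 1)%N) (sqfree a).
Proof.
apply: (iffP allP) => [sa i|sa i _ //].
by have [/sa//|] := boolP (i \in finsupp a); rewrite memNfinsupp => /eqP->.
Qed.

(* Adding or removing x is a sign-reversing involution on the squarefree
   sub-multisets of nu. *)
Let tog (a : wcomp) : wcomp :=
  if x \in a then msetB a [mset x]%mset else msetD [mset x]%mset a.

Let L := [seq a <- subwc nu | sqfree a].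

Let togP (a : wcomp) : a \in L -> [/\ tog a \in L, tog (tog a) = a &
  (-1) ^+ size (tog a) = - (-1) ^+ size a :> int].
Proof.
rewrite mem_filter mem_subwc => /andP[/sqfreeP sa anu].
have le0 i : (a i <= nu i)%N by apply/msubsetP.
rewrite /tog; have [xa|xa] := boolP (x \in a).
  have xa' : x \notin msetB a [mset x]%mset by rewrite msetB11 -leqNgt.
  rewrite (negPf xa') msetB1K //; split=> //.
    rewrite mem_filter mem_subwc; apply/andP; split.
      by apply/sqfreeP => i; rewrite msetB1E (leq_trans (leq_subr _ _)).
    by apply/msubsetP => i; rewrite msetB1E (leq_trans (leq_subr _ _)).
  rewrite -[in RHS](msetB1K xa) size_msetD enum_msetn /= exprS.
  by rewrite mulN1r opprK.
have xa' : x \in msetD [mset x]%mset a by rewrite mset1D1.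
have a0 : a x = 0%N by apply/eqP; rewrite mset_eq0.
rewrite xa' msetD1K; split=> //; last first.
  by rewrite size_msetD enum_msetn /= exprS mulN1r.
rewrite mem_filter mem_subwc; apply/andP; split.
  by apply/sqfreeP => i; rewrite mset1DE; case: (i =P x) => [->|_]; rewrite ?a0 ?add0n.
by apply/msubsetP => i; rewrite mset1DE; case: (i =P x) => [->|_]; rewrite ?a0 ?add0n ?mset_gt0.
Qed.

(** The involution [tog] shows that the sum is its own opposite, hence zero in the integers. *)
Lemma sum_sqfree_sign :
  \sum_(a <- subwc nu | all (fun i => a i <= 1)%N (finsupp a)) (-1) ^+ size a = 0 :> int.
Proof.
rewrite -big_filter -/sqfree -/L; set S := (X in X = _).
have SN : S = - S.
  rewrite {1}/S (perm_big (map tog L)).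
    rewrite big_map -sumrN; by apply: eq_big_seq => a /togP[_ _ ->].
  have injt : {in L &, injective tog}.
    move=> a b /togP[_ ta _] /togP[_ tb _] e; by rewrite -ta e tb.
  have uL : uniq L by rewrite filter_uniq ?subwc_uniq.
  apply: uniq_perm; rewrite ?map_inj_in_uniq // => a.
  apply/idP/mapP => [aL|[b /togP[bL _ _] ->] //].
  by have [taL ta _] := togP aL; exists (tog a).
by move: SN; case: (S) => -[|n].
Qed.
End SquarefreeToggle.

(** Only coefficients at [nu] of size [s] matter. There each squarefree [a] below [nu] occurs for
    the single index [i = s - size a], so the coefficient is, up to sign, the sum of
    [sum_sqfree_sign]; an element of [nu] to toggle exists because [s > 0]. *)
Lemma sum_hsym_elem_sym s : (0 < s)%N ->
  \sum_(i < s.+1) (-1) ^+ i * hsym i * elsym (s - i) = 0.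
Proof.
move=> s0; apply/funext => nu; rewrite pser_sum pser0.
have coefE (i : 'I_s.+1) : ((-1) ^+ i * hsym i * elsym (s - i)) nu =
    \sum_(a <- subwc nu | all (fun j => a j <= 1)%N (finsupp a))
      ((size nu == s) && (size a == s - i)%N)%:R * (-1) ^+ (s - size a).
  have -> : ((-1) ^+ i * hsym i * elsym (s - i)) nu
      = (-1) ^+ i * (hsym i * elsym (s - i)) nu.
    rewrite -mulrA; elim: (nat_of_ord i) (hsym _ * _) => [|n IH] f; first by rewrite !mul1r.
    by rewrite !exprS -!mulrA !mulN1r pserN IH.
  (* The factors are commuted so that [a] is the exponent taken from the elementary factor. *)
  rewrite mulrC [hsym i * _]mulrC pserME mulr_suml [RHS]big_mkcond.
  apply: eq_big_seq => a; rewrite mem_subwc => anu.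
  rewrite /elem_sym /hsym size_msetB //.
  case: all; rewrite ?andbT ?andbF ?mul0r //.
  have le_a := size_msubset anu.
  have [ea|] := eqVneq; last by rewrite andbF !mul0r.
  have le_i : (i <= s)%N by rewrite -ltnS.
  rewrite andbT mul1r; congr (_%:R * _); last by rewrite ea subKn.
  congr (nat_of_bool _); apply/eqP/eqP; lia.
under eq_bigr => i _ do rewrite coefE.
rewrite exchange_big /=; have [nus|] := eqVneq (size nu) s; last first.
  by move=> _; rewrite big1 // => a _; rewrite big1 // => i _; rewrite mul0r.
have [x xnu] : exists x, x \in nu.
  case: (mset_0Vmem nu) => [nu0|[x xnu]]; last by exists x.
  by move: s0; rewrite -nus nu0 size_mset0.
transitivity ((-1) ^+ s * \sum_(a <- subwc nu | all (fun j => a j <= 1)%N (finsupp a))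
   (-1) ^+ size a :> int); last by rewrite (sum_sqfree_sign xnu) mulr0.
rewrite mulr_sumr big_seq_cond [RHS]big_seq_cond; apply: eq_bigr => a.
rewrite mem_subwc => /andP[/size_msubset]; rewrite nus => le_a _.
have lt_a : (s - size (a : wcomp) < s.+1)%N by rewrite ltnS leq_subr.
rewrite (bigD1 (Ordinal lt_a)) //= subKn // eqxx mul1r big1 => [|i ne_i].
  by rewrite addr0 -signr_odd oddB // -[in RHS]signr_odd -[in X in _ * X]signr_odd signr_addb.
case: eqP => [e|]; last by rewrite mul0r.
case/eqP: ne_i; apply: val_inj => /=; rewrite e subKn //; by rewrite -ltnS.
Qed.

(** * Nonnegative combinations of products of elementary symmetric functions *)

Definition ecomb (l : seq (seq nat)) : pser :=
  \sum_(la <- l) \prod_(k <- la) elsym k.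

(** Lists with repetition stand for nonnegative integer coefficients, and the indices of a product
    may be unsorted or zero, so that sums and products of series become concatenations. *)
Definition econe (d : nat) (f : pser) :=
  exists2 l, all (fun la => sumn la == d) l & f = ecomb l.

Lemma econe0 d : econe d 0.
Proof. by exists [::]; rewrite // /ecomb big_nil. Qed.

Lemma econe1 : econe 0 1.
Proof. by exists [:: [::]]; rewrite // /ecomb big_seq1 big_nil. Qed.

Lemma econe_elem_sym k : econe k (elsym k).
Proof. by exists [:: [:: k]]; rewrite /= ?addn0 ?eqxx // /ecomb !big_seq1. Qed.

Lemma econeD d f g : econe d f -> econe d g -> econe d (f + g).
Proof.
move=> [l hl ->] [l' hl' ->]; exists (l ++ l'); first by rewrite all_cat hl hl'.
by rewrite /ecomb big_cat.
Qed.

Lemma econe_sum d (I : Type) (r : seq I) (P : pred I) (F : I -> pser) :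
  (forall i, P i -> econe d (F i)) -> econe d (\sum_(i <- r | P i) F i).
Proof. by move=> hF; elim/big_ind: _ => //; [apply: econe0|apply: econeD]. Qed.

Lemma econeM d d' f g : econe d f -> econe d' g -> econe (d + d') (f * g).
Proof.
move=> [l /allP hl ->] [l' /allP hl' ->].
exists [seq la ++ la' | la <- l, la' <- l'].
  apply/allP => _ /allpairsP[[la la'] /= [/hl/eqP<- /hl'/eqP<- ->]].
  by rewrite sumn_cat.
rewrite /ecomb big_allpairs_dep mulr_suml; apply: eq_bigr => la _.
by rewrite mulr_sumr; apply: eq_bigr => la' _; rewrite big_cat.
Qed.

Lemma econe_prod (I : eqType) (r : seq I) (d : I -> nat) (F : I -> pser) :
  {in r, forall i, econe (d i) (F i)} ->
  econe (\sum_(i <- r) d i) (\prod_(i <- r) F i).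
Proof.
move=> hF; rewrite big_seq [in X in econe _ X]big_seq.
by elim/big_ind2: _ => //; [apply: econe1|move=> d1 f1 d2 f2; apply: econeM].
Qed.

Lemma econe_homog d f : econe d f -> homog d f.
Proof.
move=> [l /allP hl ->] nu; rewrite /ecomb pser_sum => nz.
have /hasP[la /hl/eqP <-] : has (fun la => (\prod_(k <- la) elsym k) nu != 0) l.
  apply: contraNT nz => /hasPn all0; rewrite big1_seq // => la /andP[_ /all0].
  by rewrite negbK => /eqP.
rewrite sumnE; apply: (homog_prod (d := id)) => k _; exact: elem_sym_homog.
Qed.

Lemma elem_sym_partE la : (elem_sym_part la : pser) = \prod_(k <- la) elsym k.
Proof. by elim: la => [|k la /= ->]; rewrite ?big_nil // big_cons. Qed.

(** Since [elem_sym 0] is 1, dropping zeros and sorting turns each product into one indexed by a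
    partition; the coefficient of [la] counts the products that normalise to [la]. *)
Lemma econe_positive d (f : pser) : econe d f -> e_positive d f.
Proof.
move=> [l /allP hl ->].
pose nrm (m : seq nat) := sort geq [seq k <- m | (0 < k)%N].
exists (fun la => \sum_(m <- l) (nrm m == la)%:R).
  by move=> la _; apply: Num.Theory.sumr_ge0 => m _; rewrite Num.Theory.ler0n.
move=> nu; rewrite fsbig_finite; last exact: finite_is_part.
under eq_bigr => la _ do rewrite mulr_suml.
rewrite exchange_big /ecomb pser_sum; apply: eq_big_seq => m /hl /eqP sm.
have mP : is_part d (nrm m).
  apply/and3P; split; first by apply: sort_sorted => a b; apply: leq_total.
    by rewrite mem_sort mem_filter.
  rewrite (perm_sumn (permEl (perm_sort _ _))) -sm; apply/eqP.
  by rewrite sumn_filter sumnE big_mkcond; apply: eq_bigr => -[].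
rewrite (bigD1_seq (nrm m)) ?fset_uniq //=; last first.
  by rewrite in_fset_set; [apply/mem_set|apply: finite_is_part].
rewrite eqxx mul1r [X in _ + X]big1 => [|la /eqP ne]; last first.
  by case: (nrm m =P la) => [e|_]; rewrite ?mul0r //; case: ne.
rewrite addr0; congr (_ nu); rewrite -[RHS]/(elem_sym_part (nrm m) : pser).
rewrite elem_sym_partE (perm_big _ (permEl (perm_sort _ _))) /= big_filter.
rewrite [RHS]big_mkcond; apply: eq_bigr => -[|k] _ //=; exact: elem_sym0.
Qed.

(** * The series of a connected set *)

Section PolyFunctional.
Variable R : comNzRingType.
Implicit Types (a : nat -> R) (p q : {poly R}) (c : R).

(** An umbral evaluation: the linear functional replacing ['X^i] by [a i], with no multiplicativity
    assumed. *)
Definition lin_eval a p : R := \sum_(i < size p) p`_i * a i.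

Lemma lin_eval_wide a p n : (size p <= n)%N -> lin_eval a p = \sum_(i < n) p`_i * a i.
Proof.
move=> le_n; rewrite /lin_eval (big_ord_widen _ (fun i => p`_i * a i) le_n) big_mkcond.
by apply: eq_bigr => i _; case: ltnP => // /leq_sizeP->; rewrite ?mul0r.
Qed.

Lemma lin_eval0 a : lin_eval a 0 = 0.
Proof. by rewrite /lin_eval size_poly0 big_ord0. Qed.

Lemma lin_evalD a p q : lin_eval a (p + q) = lin_eval a p + lin_eval a q.
Proof.
rewrite !(@lin_eval_wide a _ (maxn (size p) (size q))) ?leq_maxl ?leq_maxr ?size_polyD //.
by rewrite -big_split; apply: eq_bigr => i _; rewrite coefD mulrDl.
Qed.

Lemma lin_eval_sum a (I : Type) (r : seq I) (P : pred I) (F : I -> {poly R}) :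
  lin_eval a (\sum_(i <- r | P i) F i) = \sum_(i <- r | P i) lin_eval a (F i).
Proof. by apply: (big_morph (lin_eval a)) => [p q|]; rewrite ?lin_evalD ?lin_eval0. Qed.

Lemma lin_evalZ a c p : lin_eval a (c *: p) = c * lin_eval a p.
Proof.
rewrite (lin_eval_wide _ (size_scale_leq c p)) mulr_sumr.
by apply: eq_bigr => i _; rewrite coefZ mulrA.
Qed.

Lemma lin_evalC a c : lin_eval a c%:P = c * a 0%N.
Proof.
rewrite (@lin_eval_wide _ _ 1) ?big_ord1 ?coefC //.
by rewrite size_polyC leq_b1.
Qed.

Lemma lin_evalX a p : lin_eval a ('X * p) = lin_eval (a \o succn) p.
Proof.
rewrite (@lin_eval_wide _ _ (size p).+1) ?big_ord_recl ?coefXM ?mul0r ?add0r.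
  by apply: eq_bigr => i _; rewrite coefXM.
by rewrite mulrC (leq_trans (size_polyMleq _ _)) // size_polyX addn2.
Qed.


End PolyFunctional.
(* What a leading run of length s contributes when its first i blocks, 0 <= i <= s,
   are split off and join k others in a complete homogeneous function. *)
Definition he_tail (k s : nat) : pser :=
  \sum_(i < s.+1) (-1) ^+ (k + i) * hsym (k + i) * elsym (s - i).

Lemma he_tail0 k : he_tail k 0 = (-1) ^+ k * hsym k.
Proof. by rewrite /he_tail big_ord1 addn0 subnn elem_sym0 mulr1. Qed.

Lemma he_tailS k s : he_tail k s.+1 = (-1) ^+ k * hsym k * elsym s.+1 + he_tail k.+1 s.
Proof.
rewrite /he_tail big_ord_recl addn0 subn0; congr (_ + _).
by apply: eq_bigr => i _; rewrite /= /bump /= addnA addn1 add1n subSS.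
Qed.

Section Blocks.
Variables (V : finType) (E : rel V) (s : seq V).
Implicit Types (B D : {set V}) (d k n : nat) (L : seq {set V}).

Notation conn := (induces_connected E).

(* Equals [size s] when B is empty. *)
Definition min_rank B := find (mem B) s.

Definition cuttable B D :=
  [&& D \subset B, D != set0, conn D, conn (B :\: D) & min_rank B < min_rank D]%N.

Lemma cuttable_card B D : cuttable B D -> (#|D| < #|B|)%N /\ (#|B :\: D| < #|B|)%N.
Proof.
case/and5P=> DB D0 _ _ mBD; rewrite cardsD (setIidPr DB).
have DpB : D \proper B.
  by rewrite properEneq DB andbT; apply: contraTneq mBD => ->; rewrite ltnn.
have := proper_card DpB; move: D0; rewrite -card_gt0; lia.
Qed.

(* The fuel n is exact as soon as #|B| <= n.  The coefficient of 'X^j in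
   gamma_rec n B d sums over the words D_m, ..., D_1 of blocks partitioning B minus its
   least vertex, with every B :\: (D_m :|: ... :|: D_i) connected: j is the
   length of the leading run, i.e. the longest prefix with decreasing ranks
   starting below d; each later run of length l contributes e_l, and each block
   contributes its own series.  Replacing 'X^j by e_j thus counts the leading run
   as well. *)
Fixpoint gamma_rec n B d : {poly pser} :=
  if n is n'.+1 then
    (#|B| == 1)%:R + \sum_(D | cuttable B D)
      lin_eval (fun i => elsym i) (gamma_rec n' D (size s)) *:
        (if (min_rank D < d)%N then 'X * gamma_rec n' (B :\: D) (min_rank D)
         else (lin_eval (fun i => elsym i) ('X * gamma_rec n' (B :\: D) (min_rank D)))%:P)
  else 0.

Lemma gamma_rec_fuel n n' B d : (0 < #|B|)%N -> (#|B| <= n)%N -> (#|B| <= n')%N ->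
  gamma_rec n B d = gamma_rec n' B d.
Proof.
elim: n n' B d => [|n IH] [|n'] B d B0 /= le_n le_n'; try lia.
congr (_ + _); apply: eq_bigr => D cut.
have [cD cBD] := cuttable_card cut.
have D0 : (0 < #|D|)%N by case/and5P: cut => _; rewrite -card_gt0.
have BD0 : (0 < #|B :\: D|)%N.
  by rewrite cardsD (setIidPr _) ?subn_gt0 //; case/and5P: cut.
by rewrite !(IH n' D) ?(IH n' (B :\: D)) //; lia.
Qed.

(** This is the series b(B). The bound [size s] exceeds the rank of every set that meets [s], so it
    does not cut the leading run short. *)
Definition block_series B : pser := lin_eval (fun i => elsym i) (gamma_rec #|B| B (size s)).

Definition gamma B d := gamma_rec #|B| B d.

Lemma gammaE B d : (0 < #|B|)%N -> gamma B d =
  (#|B| == 1)%:R + \sum_(D | cuttable B D)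
      block_series D *: (if (min_rank D < d)%N then 'X * gamma (B :\: D) (min_rank D)
         else (lin_eval (fun i => elsym i) ('X * gamma (B :\: D) (min_rank D)))%:P).
Proof.
move=> B0; rewrite /gamma -{1}(prednK B0) /=.
congr (_ + _); apply: eq_bigr => D cut; rewrite /block_series.
have [cD cBD] := cuttable_card cut.
have D0 : (0 < #|D|)%N by case/and5P: cut => _; rewrite -card_gt0.
have BD0 : (0 < #|B :\: D|)%N.
  by rewrite cardsD (setIidPr _) ?subn_gt0 //; case/and5P: cut.
by rewrite !(@gamma_rec_fuel #|B|.-1 #|D| D) ?(@gamma_rec_fuel #|B|.-1 #|B :\: D| (B :\: D)) //; lia.
Qed.

Lemma cuttable_gt0 B D : cuttable B D -> (0 < #|D|)%N /\ (0 < #|B :\: D|)%N.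
Proof.
move=> cut; have [cD _] := cuttable_card cut.
case/and5P: cut => DB; rewrite -card_gt0 => -> _ _ _; split=> //.
by rewrite cardsD (setIidPr DB) subn_gt0.
Qed.

(* Whether the leading run is broken off at d is irrelevant once it is evaluated. *)
Lemma block_seriesE B d : (0 < #|B|)%N -> lin_eval (fun i => elsym i) (gamma B d) = block_series B.
Proof.
move=> B0; rewrite /block_series -/(gamma B _) !gammaE // !lin_evalD; congr (_ + _).
rewrite !lin_eval_sum; apply: eq_bigr => D _; rewrite !lin_evalZ; congr (_ * _).
by case: ltnP => _; case: ltnP => _ //; rewrite lin_evalC elem_sym0 mulr1.
Qed.

(** Giving ['X^i] degree [i] makes [gamma B d] homogeneous of degree [#|B| - 1], and the recursion
    only adds, multiplies, and replaces ['X^j] by [elem_sym j]. Vanishing from [#|B|] on is carried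
    along because the subtraction in the degree is truncated. *)
Lemma econe_gamma B d i : (0 < #|B|)%N ->
  if (i < #|B|)%N then econe (#|B|.-1 - i) (gamma B d)`_i else (gamma B d)`_i = 0.
Proof.
have [n] := ubnP #|B|; elim: n B d i => // n IH B d i ltBn B0.
have econe_b D : (0 < #|D|)%N -> (#|D| < n)%N -> econe #|D|.-1 (block_series D).
  move=> D0 ltD; rewrite -(block_seriesE 0 D0) /lin_eval; apply: econe_sum => j _.
  have := IH D 0%N j ltD D0; case: ltnP => [ltj cj|_ ->]; last by rewrite mul0r; apply: econe0.
  have -> : #|D|.-1 = (#|D|.-1 - j + j)%N by lia.
  by apply: econeM cj (econe_elem_sym _).
rewrite gammaE // coefD coef_sum.
have coef_nat : ((#|B| == 1)%:R : {poly pser})`_i = ((#|B| == 1) && (i == 0%N))%:R.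
  by rewrite coefMn coef1; case: (#|B| == 1); case: (i == 0%N); rewrite ?mulr1n ?mulr0n.
rewrite {}coef_nat.
have sumP D : cuttable B D ->
   let c := (block_series D *: (if (min_rank D < d)%N then 'X * gamma (B :\: D) (min_rank D)
         else (lin_eval (fun i => elsym i) ('X * gamma (B :\: D) (min_rank D)))%:P))`_i in
   if (i < #|B|)%N then econe (#|B|.-1 - i) c else c = 0.
  move=> cut /=; have [cD cBD] := cuttable_card cut; have [D0 BD0] := cuttable_gt0 cut.
  have cardB : #|B| = (#|D| + #|B :\: D|)%N.
    by rewrite cardsD (setIidPr _) ?subnKC ?(ltnW cD) //; case/and5P: cut.
  have cb := econe_b D D0 ltac:(lia).
  have IHBD j := IH (B :\: D) (min_rank D) j ltac:(lia) BD0.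
  rewrite coefZ; case: (ltnP (min_rank D) d) => _.
    rewrite coefXM; case: i => [|i] /=; first by rewrite mulr0 B0; apply: econe0.
    have := IHBD i; case: ltnP => [lti ci|lei ->]; last first.
      by rewrite mulr0; case: ifP => // _; apply: econe0.
    rewrite ifT; last by lia.
    have -> : (#|B|.-1 - i.+1 = #|D|.-1 + (#|B :\: D|.-1 - i))%N by lia.
    exact: econeM.
  rewrite coefC; case: i => [|i] /=; last first.
    by rewrite mulr0; case: ifP => // _; apply: econe0.
  rewrite B0 lin_evalX /lin_eval subn0 /=.
  have -> : (#|B|.-1 = #|D|.-1 + #|B :\: D|)%N by lia.
  apply: econeM => //; apply: econe_sum => j _.
  have := IHBD j; case: ltnP => [ltj cj|_ ->]; last by rewrite mul0r; apply: econe0.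
  have -> : #|B :\: D| = (#|B :\: D|.-1 - j + j.+1)%N by lia.
  by apply: econeM cj (econe_elem_sym _).
case: ifP => ltiB; last first.
  rewrite big1 ?addr0 => [|D /sumP]; last by rewrite ltiB.
  have -> : (#|B| == 1) && (i == 0%N) = false by lia.
  by [].
apply: econeD; last by apply: econe_sum => D /sumP; rewrite ltiB.
case: andP => [[/eqP-> /eqP->]|_]; [exact: econe1|exact: econe0].
Qed.

Lemma econe_block_series B : (0 < #|B|)%N -> econe #|B|.-1 (block_series B).
Proof.
move=> B0; rewrite -(block_seriesE 0 B0) /lin_eval; apply: econe_sum => j _.
have := econe_gamma 0 j B0; case: ltnP => [ltj cj|_ ->]; last by rewrite mul0r; apply: econe0.
have -> : #|B|.-1 = (#|B|.-1 - j + j)%N by lia.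
by apply: econeM cj (econe_elem_sym _).
Qed.

(* The partitions of B reached by repeatedly cutting off the block of largest rank,
   the ranks decreasing from below d. *)
Fixpoint cut_lists n B d : seq (seq {set V}) :=
  [:: B] :: if n is n'.+1 then
    [seq D :: L | D <- [seq D <- enum {set V} | cuttable B D && (min_rank D < d)%N],
                  L <- cut_lists n' (B :\: D) (min_rank D)]
  else [::].

Lemma cut_lists_neq0 n B d L : L \in cut_lists n B d -> (0 < size L)%N.
Proof.
case: n => [|n]; rewrite /= in_cons => /predU1P[->|] //.
by case/allpairsPdep=> [? [? [_ _ ->]]].
Qed.

(** Either no block of the leading run is split off, and the whole run is evaluated in elementary
    functions, or its first block is, which lowers the power of ['X] and raises [k] by one. *)
Lemma lin_eval_he_tail k (q : {poly pser}) c :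
  lin_eval (he_tail k) ('X * q + c%:P) =
  (-1) ^+ k * hsym k * lin_eval (fun i => elsym i) ('X * q + c%:P) + lin_eval (he_tail k.+1) q.
Proof.
rewrite !lin_evalD !lin_evalX !lin_evalC he_tail0 elem_sym0 mulr1 mulrDr [c * _]mulrC addrAC.
congr (_ + _); rewrite /lin_eval mulr_sumr -big_split; apply: eq_bigr => i _ /=.
by rewrite he_tailS mulrDr mulrCA.
Qed.

Lemma lin_eval_scale_sum (a : nat -> pser) (I : Type) (r : seq I) (P : pred I) (c : I -> pser) F :
  lin_eval a (\sum_(i <- r | P i) c i *: F i) = \sum_(i <- r | P i) c i * lin_eval a (F i).
Proof. by rewrite lin_eval_sum; apply: eq_bigr => i _; rewrite lin_evalZ. Qed.

(** Induction along [lin_eval_he_tail]: the list [[:: B]] is the term where nothing is split off,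
    and a list [D :: L] is the splitting off of the first block [D] of the run. *)
Lemma sum_cut_lists n B d k : (0 < #|B|)%N -> (#|B| <= n)%N ->
  \sum_(L <- cut_lists n B d)
    (-1) ^+ (k + (size L).-1) * hsym (k + (size L).-1) * \prod_(D <- L) block_series D
  = lin_eval (he_tail k) (gamma B d).
Proof.
elim: n B d k => [|n IH] B d k B0 len /=; first lia.
rewrite big_cons big_seq1 addn0.
rewrite big_allpairs_dep big_filter big_enum_cond /=.
(* Words with a nonempty leading run, collected in ['X * q], are separated from those whose leading
   run is empty, collected in [c]. *)
pose q := \sum_(D | cuttable B D && (min_rank D < d)%N) block_series D *: gamma (B :\: D) (min_rank D).
pose c := (#|B| == 1)%:R + \sum_(D | cuttable B D && ~~ (min_rank D < d)%N)
  block_series D * lin_eval (fun i => elsym i) ('X * gamma (B :\: D) (min_rank D)).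
have gE : gamma B d = 'X * q + c%:P.
  rewrite gammaE // (bigID (fun D => min_rank D < d)%N) /= addrCA; congr (_ + _).
    rewrite /q mulr_sumr; apply: eq_bigr => D /andP[_ ->].
    by rewrite -scalerAr.
  rewrite /c polyCD rmorph_nat (big_morph polyC (@polyCD _) (@polyC0 _)).
  congr (_ + _); apply: eq_bigr => D /andP[_ /negPf->].
  by rewrite -mul_polyC -polyCM.
rewrite gE lin_eval_he_tail -gE block_seriesE //; congr (_ + _).
rewrite /q lin_eval_scale_sum; apply: eq_bigr => D /andP[cut _].
have [cD cBD] := cuttable_card cut; have [D0 BD0] := cuttable_gt0 cut.
rewrite -IH //; last by lia.
rewrite mulr_sumr; apply: eq_big_seq => L Lpls.
rewrite big_cons mulrCA; congr (_ * _).
suff -> : (k + size L = k.+1 + (size L).-1)%N by [].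
by rewrite addSnnS (prednK (cut_lists_neq0 Lpls)).
Qed.

(** As [B] is not a singleton and every rank is below [size s], no leading run is empty, so [gamma]
    has no constant term; each [he_tail 0 i] with [i > 0] vanishes by [sum_hsym_elem_sym]. *)
Lemma sum_cut_lists0 B : (1 < #|B|)%N ->
  (forall D, D != set0 -> D \subset B -> min_rank D < size s)%N ->
  \sum_(L <- cut_lists #|B| B (size s))
    (-1) ^+ (size L).-1 * hsym (size L).-1 * \prod_(D <- L) block_series D = 0.
Proof.
move=> B1 hs; rewrite (sum_cut_lists _ 0) ?(ltnW B1) // /lin_eval big1 // => -[[|i] /= _] _.
  rewrite gammaE ?(ltnW B1) // coefD gtn_eqF // coef0 add0r coef_sum big1 ?mul0r // => D cut.
  rewrite hs; first by rewrite coefZ coefXM mulr0.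
    by case/and5P: cut.
  by case/and5P: cut.
rewrite [he_tail _ _](_ : _ = 0) ?mulr0 // -[RHS](sum_hsym_elem_sym (s := i.+1)) //.
Qed.
End Blocks.

(** * Connected partitions as sorted lists *)

Section ListPartitions.
Variables (V : finType) (E : rel V) (s : seq V).
Hypotheses (symE : symmetric E) (s_all : forall v, v \in s).
Implicit Types (B D : {set V}) (d k n : nat) (L : seq {set V}).

Notation conn := (induces_connected E).
Notation min_rank := (min_rank s).
Notation cuttable := (cuttable E s).
Notation cut_lists := (cut_lists E s).

(* The form in which a perfect elimination order s is used: within a connected set
   every vertex but the first has an earlier neighbour. *)
Definition peo := forall B v, conn B -> v \in B -> (min_rank B < index v s)%N ->
  exists u, [/\ u \in B, (index u s < index v s)%N & E u v].

Definition relin B : rel V := [rel u v | [&& u \in B, v \in B & E u v]].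

Lemma relin_sym B : connect_sym (relin B).
Proof.
suff sym : symmetric (relin B) by move=> u v; apply: (sym_connect_sym sym).
by move=> u v; rewrite /relin /= symE; case: (u \in B); case: (v \in B).
Qed.

Lemma connP B : reflect {in B &, forall x y, connect (relin B) x y} (conn B).
Proof.
apply: (iffP forall_inP) => [cB x y xB yB|cB x xB]; first exact: (forall_inP (cB x xB)).
by apply/forall_inP => y; apply: cB.
Qed.

Lemma connect_relinS B B' x y :
  B \subset B' -> connect (relin B) x y -> connect (relin B') x y.
Proof.
move=> BB'; apply: connect_sub => u v /and3P[uB vB Euv].
by apply: connect1; rewrite /relin /= !(subsetP BB') ?Euv.
Qed.

Lemma index_inj_all : injective (index^~ s).
Proof. by move=> u v e; rewrite -(nth_index u (s_all u)) e nth_index. Qed.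

Lemma min_rank_le B v : v \in B -> (min_rank B <= index v s)%N.
Proof.
move=> vB; rewrite /min_rank leqNgt; apply/negP => lt.
by have := before_find v lt; rewrite nth_index //= vB.
Qed.

Lemma min_rank_ex B : B != set0 -> exists2 v, v \in B & index v s = min_rank B.
Proof.
case/set0Pn=> v0 v0B; have hasB : has (mem B) s by apply/hasP; exists v0.
have := nth_find v0 hasB; set v := nth _ _ _ => vB; exists v => //.
apply/eqP; rewrite eqn_leq min_rank_le // andbT.
by rewrite leqNgt; apply/negP => /(before_find v0)/=; rewrite -/v eqxx.
Qed.

Lemma min_rank_lt B : B != set0 -> (min_rank B < size s)%N.
Proof. by case/min_rank_ex => v _ <-; rewrite index_mem. Qed.

Lemma min_rank_sub B D : D != set0 -> D \subset B -> (min_rank B <= min_rank D)%N.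
Proof. by case/min_rank_ex => v vD <- /subsetP DB; apply/min_rank_le/DB. Qed.

Lemma min_rank_setD B D : B != set0 -> (min_rank B < min_rank D)%N -> min_rank (B :\: D) = min_rank B.
Proof.
case/min_rank_ex=> v vB ev lt.
have vBD : v \in B :\: D.
  by rewrite inE vB andbT; apply: contraL lt => /min_rank_le; rewrite ev -leqNgt.
apply/eqP; rewrite eqn_leq -{1}ev min_rank_le //= min_rank_sub ?subsetDl //.
by apply/set0Pn; exists v.
Qed.

(** The strict order by decreasing least vertex makes the list of a connected partition unique, so
    that sums over lists count partitions. *)
Record plist B L : Prop := Plist {
  plist_sorted : sorted (fun D D' => min_rank D' < min_rank D)%N L;
  plist_neq0 : {in L, forall D, D != set0};
  plist_conn : {in L, forall D, conn D};
  plist_sub : {in L, forall D, D \subset B};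
  plist_cover : forall v, v \in B -> exists2 D, D \in L & v \in D;
  plist_disj : forall D D' v, D \in L -> D' \in L -> v \in D -> v \in D' -> D = D' }.

Let set_rank_gt : rel {set V} := fun D D' => (min_rank D' < min_rank D)%N.
Lemma set_rank_gt_trans : transitive set_rank_gt.
Proof. by move=> D2 D1 D3 h1 h2; apply: ltn_trans h2 h1. Qed.

Lemma plist1 B D : plist B [:: D] -> D = B.
Proof.
move=> [_ _ _ sub cov _]; apply/eqP; rewrite eqEsubset sub ?mem_head //.
by apply/subsetP => v /cov[D']; rewrite inE => /eqP->.
Qed.

Lemma plist_cons B D L : plist B (D :: L) -> plist (B :\: D) L.
Proof.
move=> [srt n0 cn sub cov dj].
have gt : {in L, forall D', (min_rank D' < min_rank D)%N}.
  by apply/allP; apply: (order_path_min set_rank_gt_trans srt).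
have inL D' : D' \in L -> D' \in D :: L by rewrite in_cons orbC => ->.
split.
- exact: path_sorted srt.
- by move=> D' /inL; apply: n0.
- by move=> D' /inL; apply: cn.
- move=> D' D'L; apply/subsetP => v vD'; rewrite inE (subsetP (sub D' (inL _ D'L))) // andbT.
  apply/negP => vD; have := gt D' D'L.
  by rewrite (dj D D' v) ?mem_head ?ltnn //; apply: inL.
- move=> v; rewrite inE => /andP[vD /cov[D']]; rewrite inE => /predU1P[->|D'L] vD'.
    by rewrite vD' in vD.
  by exists D'.
- by move=> D1 D2 v /inL D1L /inL D2L; apply: dj.
Qed.

(* The least vertex of every other block has an earlier neighbour in B, which
   lies outside D since D starts later; so every vertex descends to the first. *)
Lemma conn_setD_last B D D' L : peo -> conn B -> plist B [:: D, D' & L] ->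
  conn (B :\: D).
Proof.
move=> hpeo cB pl; have pl' := plist_cons pl.
case: (pl) => srt n0 cn sub cov dj.
have gt : {in D' :: L, forall D'', (min_rank D'' < min_rank D)%N}.
  by apply/allP; apply: (order_path_min set_rank_gt_trans srt).
have D'0 : D' != set0 by apply: n0; rewrite !inE eqxx orbT.
have B0 : B != set0.
  case/set0Pn: D'0 => v vD'; apply/set0Pn; exists v.
  by apply: (subsetP (sub D' _)) vD'; rewrite !inE eqxx orbT.
have [w wB ew] := min_rank_ex B0.
have toW v : v \in B :\: D -> connect (relin (B :\: D)) v w.
  have [n] := ubnP (index v s); elim: n v => // n IH v ltn vBD.
  have [D1 D1L vD1] := plist_cover pl' vBD.
  have D1L' : D1 \in [:: D, D' & L] by rewrite in_cons D1L orbT.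
  have [m mD1 em] := min_rank_ex (plist_neq0 pl' D1L).
  apply: (@connect_trans _ _ m).
    apply: (connect_relinS (plist_sub pl' D1L)).
    by apply: (connP _ (plist_conn pl' D1L)).
  have mB : m \in B by apply: (subsetP (sub D1 D1L')).
  have [lt|] := ltnP (min_rank B) (index m s); last first.
    rewrite -ew => le; have : index m s = index w s.
      by apply/eqP; rewrite eqn_leq le /= ew min_rank_le.
    by move/index_inj_all->; apply: connect0.
  have [u [uB lt_um Eum]] := hpeo B m cB mB lt.
  have uBD : u \in B :\: D.
    rewrite inE uB andbT; apply/negP => /min_rank_le; rewrite leqNgt => /negP; apply.
    by apply: ltn_trans lt_um _; rewrite em gt.
  have mBD : m \in B :\: D by apply: (subsetP (plist_sub pl' D1L)).
  apply: (@connect_trans _ _ u); last first.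
    apply: IH => //; apply: leq_trans lt_um _; rewrite em.
    by apply: leq_trans (min_rank_le vD1) _; rewrite -ltnS.
  by apply: connect1; rewrite /relin /= uBD mBD symE.
apply/connP => x y xBD yBD; apply: connect_trans (toW x xBD) _.
by rewrite relin_sym; apply: toW.
Qed.

(** The head of a sorted list has the largest rank, and [conn_setD_last] makes it cuttable. The
    bound [d] concerns only a block that is actually cut off, hence lists of at least two blocks. *)
Lemma mem_cut_lists n B d L : peo -> conn B -> B != set0 -> (#|B| <= n)%N ->
  L \in cut_lists n B d <-> plist B L /\ (if L is D :: _ :: _ then min_rank D < d else true)%N.
Proof.
move=> hpeo; elim: n B d L => [|n IH] B d L cB B0 len.
  by move: B0; rewrite -card_gt0; lia.
have pl1 : plist B [:: B].
  split=> //.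
  - by move=> D; rewrite inE => /eqP->.
  - by move=> D; rewrite inE => /eqP->.
  - by move=> D; rewrite inE => /eqP->.
  - by move=> v vB; exists B; rewrite ?inE.
  - by move=> D D' v; rewrite !inE => /eqP-> /eqP->.
have nB0 D : cuttable B D -> B :\: D != set0.
  by move=> cut; rewrite -card_gt0; have [] := cuttable_gt0 cut.
split.
  rewrite /= inE => /predU1P[->|]; first by [].
  case/allpairsPdep=> D [L' [+ + ->]]; rewrite mem_filter => /andP[/andP[cut ltd] _].
  have [_ cBD] := cuttable_card cut.
  have cnBD : conn (B :\: D) by case/and5P: cut.
  move/(IH _ _ _ cnBD (nB0 D cut) (leq_trans cBD len)) => [pl cond].
  case/and5P: cut => DB D0 cD _ mBD.
  (* If [L'] has one block only, that block is [B :\: D], which has the rank of [B]; otherwise the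
     bound in [cond] applies. *)
  have lt_hd : path set_rank_gt D L'.
    have := plist_sorted pl; case: L' pl cond => //= D1 L' pl cond srt.
    rewrite srt andbT /set_rank_gt; case: L' pl cond {srt} => // pl _.
    by rewrite (plist1 pl) min_rank_setD.
  split; last by case: (L').
  case: pl => srt n0 cn sub cov dj.
  have subD D1 v : D1 \in L' -> v \in D1 -> v \in D -> False.
    by move=> /sub /subsetP sD1 /sD1; rewrite inE => /andP[/negPf->].
  split=> //.
  - by move=> D1; rewrite inE => /predU1P[->|/n0].
  - by move=> D1; rewrite inE => /predU1P[->|/cn].
  - move=> D1; rewrite inE => /predU1P[->//|/sub sD1].
    exact: subset_trans sD1 (subsetDl _ _).
  - move=> v vB; have [vD|vD] := boolP (v \in D); first by exists D; rewrite ?mem_head.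
    have [|D1 D1L vD1] := cov v; first by rewrite inE vD.
    by exists D1; rewrite // in_cons D1L orbT.
  - move=> D1 D2 v; rewrite !inE => /predU1P[->|D1L] /predU1P[->|D2L] // v1 v2.
    + by case: (subD D2 v).
    + by case: (subD D1 v).
    + exact: dj v1 v2.
move=> [pl cond]; rewrite /= inE.
case: L pl cond => [|D [|D' L]] pl cond.
- by case/set0Pn: B0 => v /(plist_cover pl)[].
- by rewrite (plist1 pl) eqxx.
apply/orP; right.
have inD : D \in [:: D, D' & L] by rewrite mem_head.
have inD' : D' \in [:: D, D' & L] by rewrite !inE eqxx orbT.
have cut : cuttable B D.
  apply/and5P; split.
  - exact: (plist_sub pl).
  - exact: (plist_neq0 pl).
  - exact: (plist_conn pl).
  - exact: conn_setD_last hpeo cB pl.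
  - case: (pl) => /andP[lt _] *.
    by apply: leq_ltn_trans lt; apply: min_rank_sub; [apply: (plist_neq0 pl)|apply: (plist_sub pl)].
have [_ cBD] := cuttable_card cut.
apply/allpairsPdep; exists D, (D' :: L); split=> //.
  by rewrite mem_filter cut cond mem_enum.
have cnBD : conn (B :\: D) by case/and5P: cut.
apply/(IH _ _ _ cnBD (nB0 D cut) (leq_trans cBD len)); split; first exact: plist_cons pl.
case: (pl) => /= /andP[lt _] *; by case: (L).
Qed.

Lemma cut_lists_uniq n B d : uniq (cut_lists n B d).
Proof.
elim: n B d => //= n IH B d; apply/andP; split.
  by apply/allpairsPdep => -[D [L [_ /cut_lists_neq0 + [_ eL]]]]; rewrite -eL.
apply: allpairs_uniq_dep => [|D _|].
- by rewrite filter_uniq ?enum_uniq.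
- exact: IH.
- by move=> [D L] [D' L'] _ _ /= [-> ->].
Qed.
End ListPartitions.

(** * Perfect elimination orders of chordal graphs *)

Section Chordal.
Variables (V : finType) (E : rel V).
Hypotheses (symE : symmetric E) (irrE : irreflexive E).
Implicit Types (S C : {set V}) (p q r : seq V) (x y z v w : V).

(** The vertex sequence of an induced path. *)
Fixpoint chordless r : bool :=
  if r is x :: p then
    [&& x \notin p, (if p is y :: q then E x y && all (fun z => ~~ E x z) q else true)
      & chordless p]
  else true.

Lemma chordless_uniq r : chordless r -> uniq r.
Proof. by elim: r => //= x p IH /and3P[-> _ /IH]. Qed.

Lemma chordless_nth v r i j : chordless r -> (i < j < size r)%N ->
  E (nth v r i) (nth v r j) = (j == i.+1).
Proof.
elim: r i j => [|x p IH] i j; first by move=> _ /andP[].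
move=> /= /and3P[_ adj cp] /andP[ij jp].
case: i ij => [|i] ij; case: j ij jp => // j ij jp.
  2: by rewrite /= eqSS IH // -ltnS ij.
case: p adj jp {IH cp} => //= y q /andP[Exy /allP nE] jp.
case: j jp {ij} => [|j] //= jq; rewrite eqSS; apply: negbTE.
by apply: nE; rewrite mem_nth.
Qed.

(** If [x] is adjacent to, or reappears as, a vertex past the next one, the path is shortened by
    jumping there; otherwise [x] extends a chordless path starting at the next vertex. *)
Lemma chordless_path p x : path E x p ->
  exists q, [/\ {subset q <= p}, last x q = last x p & chordless (x :: q)].
Proof.
have [n] := ubnP (size p); elim: n p x => // n IH [|y l] x ltn pth.
  by exists [::].
have [/hasP[z zl zx]|no] := boolP (has (fun z => E x z || (z == x)) l).
  case/splitPr: zl ltn pth => l1 l2 ltn pth.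
  have pz : path E z l2 by move: pth => /= /andP[_]; rewrite cat_path /= => /and3P[].
  have lt2 : ((size l2).+1 < n)%N by move: ltn; rewrite /= size_cat /=; lia.
  have sub2 : {subset z :: l2 <= y :: l1 ++ z :: l2}.
    by move=> t; rewrite !in_cons mem_cat in_cons => /orP[->|->]; rewrite !orbT.
  case/orP: zx => [Exz|/eqP ez].
    have [q [sq lq cq]] := IH (z :: l2) x lt2 ltac:(by rewrite /= Exz).
    by exists q; split=> // [t /sq/sub2 //|]; rewrite lq /= last_cat.
  have [q [sq lq cq]] := IH l2 z (ltnW lt2) pz.
  rewrite ez in lq cq *; exists q; split=> // [t /sq tl2|].
    by rewrite in_cons mem_cat in_cons tl2 !orbT.
  by rewrite lq /= last_cat.
move: pth => /= /andP[Exy pl]; have [q [sq lq cq]] := IH l y ltac:(by []) pl.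
have nE t : t \in q -> ~~ (E x t || (t == x)).
  by move=> /sq tl; apply: (hasPn no).
exists (y :: q); split=> //.
  by move=> t; rewrite !in_cons => /orP[->//|/sq->]; rewrite orbT.
apply/and3P; split=> //; last first.
  by rewrite Exy; apply/allP => t /nE; rewrite negb_or => /andP[].
rewrite in_cons negb_or; apply/andP; split.
  by apply: contraTneq Exy => <-; rewrite irrE.
by apply/negP => /nE; rewrite eqxx orbT.
Qed.

(** Closing an induced path by a vertex adjacent to its two ends only gives a cycle of the form that
    [chordal] forbids. *)
Lemma chordless_cycle v r : chordless r -> (2 < size r)%N -> v \notin r ->
  (forall i, (i < size r)%N -> E v (nth v r i) = (i == 0%N) || (i == (size r).-1)) ->
  uniq (v :: r) /\ {in v :: r &, forall x y,
    E x y = (next (v :: r) x == y) || (next (v :: r) y == x)}.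
Proof.
move=> cr szr vr Ev; have uc : uniq (v :: r) by rewrite /= vr chordless_uniq.
split=> // x y xc yc.
(* The default [v] of [nth] makes the last entry wrap around to the head. *)
have nextE z : z \in v :: r -> next (v :: r) z = nth v r (index z (v :: r)).
  by move=> zc; rewrite next_nth zc.
rewrite !nextE //; move: xc yc; rewrite -!index_mem.
set i := index x _; set j := index y _ => ltn_i ltn_j.
have xE : x = nth v (v :: r) i by rewrite nth_index // -index_mem.
have yE : y = nth v (v :: r) j by rewrite nth_index // -index_mem.
have key a b : (a < size (v :: r))%N -> (b < size (v :: r))%N ->
    (nth v r a == nth v (v :: r) b) = (if a == size r then b == 0%N else b == a.+1).
  rewrite /= ltnS => lea ltb; case: (ltngtP a (size r)) lea => // [lta _|-> _].
    by rewrite -[nth v r a]/(nth v (v :: r) a.+1) nth_uniq // eq_sym.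
  by rewrite nth_default // -[X in X == _]/(nth v (v :: r) 0) nth_uniq // eq_sym.
have main a b : (a < b)%N -> (b < size (v :: r))%N ->
    E (nth v (v :: r) a) (nth v (v :: r) b) =
    (nth v r a == nth v (v :: r) b) || (nth v r b == nth v (v :: r) a).
  move=> ab bs; have as_ := ltn_trans ab bs; rewrite !key //.
  case: a ab as_ => [|a] ab as_; case: b ab bs => // b ab bs.
    rewrite [LHS]Ev //= eqSS; move: bs => /= bs.
    do !case: eqP => //=; lia.
  rewrite -[LHS]/(E (nth v r a) (nth v r b)) chordless_nth //; last by move: ab bs => /=; lia.
  rewrite eqSS; move: bs => /= bs; do !case: eqP => //=; lia.
rewrite xE yE; case: (ltngtP i j) => [ij|ji|->].
- exact: main.
- by rewrite symE orbC main.
- rewrite irrE key // orbb; case: eqP => [ej|_]; last by lia.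
  by rewrite ej; case: (r) szr.
Qed.

Hypothesis chE : chordal E.

Definition simplicial S w := {in S &, forall x y, E w x -> E w y -> x != y -> E x y}.

(* Dirac's argument: C is a component of the non-neighbours of v and T its
   attachment set.  T is a clique, as a chordless path through C between two
   nonadjacent vertices of T would close up to an induced cycle through v.
   Induction on C :|: T yields a simplicial vertex lying in C. *)
Lemma simplicial_nonadjacent S v : v \in S ->
  (exists w, [/\ w \in S, w != v & ~~ E v w]) ->
  exists w, [/\ w \in S, w != v, ~~ E v w & simplicial S w].
Proof.
have [n] := ubnP #|S|; elim: n S v => // n IH S v ltn vS [w0 [w0S w0v nEvw0]].
pose A := [set x in S | (x != v) && ~~ E v x].
pose C := [set x | connect (relin E A) w0 x].
have w0A : w0 \in A by rewrite inE w0S w0v.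
have CA x : x \in C -> x \in A.
  rewrite inE => /connectP[p pth ->]; elim/last_ind: p pth => //= p y _.
  by rewrite rcons_path last_rcons => /andP[_ /and3P[]].
have w0C : w0 \in C by rewrite inE connect0.
pose T := [set t in S | E v t && [exists c in C, E t c]].
have TC t : t \in T -> t \notin C.
  by rewrite inE => /and3P[_ Evt _]; apply/negP => /CA; rewrite inE Evt !andbF.
(* Consequently a vertex of [C] that is simplicial in [C :|: T] is simplicial in [S]. *)
have nbrC c x : c \in C -> x \in S -> E c x -> x \in C :|: T.
  move=> cC xS Ecx; rewrite inE; have := CA c cC; rewrite inE => /and3P[cS cv nEvc].
  have [Evx|nEvx] := boolP (E v x).
    by apply/orP; right; rewrite inE xS Evx; apply/exists_inP; exists c; rewrite // symE.
  apply/orP; left; have xA : x \in A.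
    by rewrite inE xS nEvx andbT; apply: contraNneq nEvc => <-; rewrite symE.
  have cA := CA c cC; move: cC; rewrite !inE => cC.
  by apply: connect_trans cC (connect1 _); rewrite /relin /= cA xA.
have cliqueT t t' : t \in T -> t' \in T -> t != t' -> E t t'.
  move=> tT t'T tt'; apply/negPn/negP => nEtt'.
  have := tT; rewrite inE => /and3P[_ Evt /exists_inP[c cC Etc]].
  have := t'T; rewrite inE => /and3P[_ Evt' /exists_inP[c' c'C Et'c']].
  have /connectP[p0 pth0 lst0] : connect (relin E A) c c'.
    have := c'C; have := cC; rewrite !inE => h1 h2.
    by apply: connect_trans h2; rewrite relin_sym.
  have p0C : {subset p0 <= C}.
    elim: (p0) (c) cC pth0 => // y l IHl x xC /= /andP[/and3P[xA yA Exy] pl] z.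
    have yC : y \in C.
      move: xC; rewrite !inE => xC; apply: connect_trans xC (connect1 _).
      by rewrite /relin /= xA yA.
    by rewrite in_cons => /predU1P[->//|]; apply: (IHl y yC pl z).
  have pth : path E t (c :: rcons p0 t').
    rewrite /= Etc rcons_path -lst0 symE Et'c' andbT.
    by apply: sub_path pth0 => x y /and3P[].
  have [q [sq lq cq]] := chordless_path pth.
  rewrite /= last_rcons in lq.
  have {lq} [q' eq] : exists q', q = rcons q' t'.
    case/lastP: q lq {sq cq} => [/= e|q' z]; first by rewrite e eqxx in tt'.
    by rewrite last_rcons => ->; exists q'.
  have uq := chordless_uniq cq.
  have q'C : {subset q' <= C}.
    move=> z zq'; have /sq : z \in q by rewrite eq mem_rcons in_cons zq' orbT.
    rewrite in_cons mem_rcons in_cons => /or3P[/eqP->//|/eqP ez|/p0C//].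
    by move: uq; rewrite eq /= rcons_uniq -ez zq' andbF.
  have q'0 : (0 < size q')%N.
    by case: q' eq {q'C} => // eq; move: cq; rewrite eq /= (negPf nEtt') andbF.
  have nEvC z : z \in C -> ~~ E v z by move/CA; rewrite inE => /and3P[].
  have vr : v \notin t :: q.
    rewrite eq in_cons mem_rcons in_cons; apply/negP => /or3P[/eqP e|/eqP e|/q'C/CA].
    - by rewrite e irrE in Evt.
    - by rewrite e irrE in Evt'.
    - by rewrite inE eqxx andbF.
  have [] := @chordless_cycle v (t :: q) cq.
  - by rewrite eq /= size_rcons.
  - exact: vr.
  - move=> [|i] /=; first by rewrite Evt.
    rewrite eq size_rcons !ltnS => le_i; rewrite nth_rcons.
    case: ltngtP le_i => // [lt_i _|ei _].
      have wC : nth v q' i \in C by apply/q'C/mem_nth.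
      by rewrite (negPf (nEvC _ wC)); rewrite eqSS ltn_eqF.
    by rewrite Evt' ei eqxx.
  move=> uc; apply: chE => //; by rewrite eq /= size_rcons.
pose S' := C :|: T.
have S'S : S' \subset S.
  apply/subsetP => x; rewrite inE => /orP[/CA|]; by rewrite inE => /and3P[].
have vS' : v \notin S'.
  rewrite inE negb_or; apply/andP; split; first by apply/negP => /CA; rewrite inE eqxx andbF.
  by rewrite inE irrE andbF.
have ltS' : (#|S'| < n)%N.
  rewrite -ltnS; apply: leq_ltn_trans ltn; apply: proper_card.
  rewrite properEneq S'S andbT; by apply: contraNneq vS' => ->.
have good w : w \in C -> simplicial S' w ->
    exists w, [/\ w \in S, w != v, ~~ E v w & simplicial S w].
  move=> wC sw; exists w; have := CA w wC; rewrite inE => /and3P[-> -> ->]; split=> //.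
  move=> x y xS yS Ewx Ewy; apply: sw => //; exact: nbrC wC _ _.
have TS' t : t \in T -> t \in S' by move=> tT; rewrite finset.in_setU tT orbT.
have CS' t : t \in C -> t \in S' by move=> tC; rewrite finset.in_setU tC.
(* The induction hypothesis is applied at a [t] with a non-neighbour in [S'], taken in [T] if
   possible. The simplicial vertex found is not adjacent to [t], so it avoids [T]: in the first case
   because [T] is a clique, in the second because [T] is joined to all of [S']. If no such [t]
   exists, [S'] is a clique and [w0] serves. *)
have [/exists_inP[t tT /exists_inP[c cS' /andP[ct nEtc]]]|noT] :=
  boolP [exists t in T, exists c in S', (c != t) && ~~ E t c].
  have [|w [wS' wt nEtw sw]] := IH S' t ltS' (TS' t tT); first by exists c.
  apply: good sw; move: wS'; rewrite inE => /orP[//|wT].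
  by rewrite cliqueT // eq_sym in nEtw.
have adjT t c : t \in T -> c \in S' -> c != t -> E t c.
  move=> tT cS' ct; apply/negPn/negP => nE; case/negP: noT.
  by apply/exists_inP; exists t => //; apply/exists_inP; exists c; rewrite ?ct.
have [/exists_inP[t tC /exists_inP[c cS' /andP[ct nEtc]]]|noC] :=
  boolP [exists t in C, exists c in S', (c != t) && ~~ E t c].
  have [|w [wS' wt nEtw sw]] := IH S' t ltS' (CS' t tC); first by exists c.
  apply: good sw; move: wS'; rewrite inE => /orP[//|wT].
  by rewrite symE adjT ?CS' // eq_sym in nEtw.
apply: (good w0 w0C) => x y xS' yS' _ _ xy.
move: (xS'); rewrite inE => /orP[xC|xT]; last by rewrite adjT // eq_sym.
apply/negPn/negP => nE; case/negP: noC.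
by apply/exists_inP; exists x => //; apply/exists_inP; exists y; rewrite // eq_sym xy.
Qed.

Lemma simplicial_ex S : S != set0 -> exists2 w, w \in S & simplicial S w.
Proof.
case/set0Pn=> v vS.
have [/exists_inP[x xS /exists_inP[w wS /andP[wx nE]]]|no] :=
  boolP [exists x in S, exists w in S, (w != x) && ~~ E x w].
  have [|u [uS _ _ su]] := simplicial_nonadjacent xS; first by exists w.
  by exists u.
exists v => // x y xS yS _ _ xy; apply/negPn/negP => nE; case/negP: no.
by apply/exists_inP; exists x => //; apply/exists_inP; exists y; rewrite // eq_sym xy.
Qed.

(** A simplicial vertex of [S] is placed last, after an order of the remaining vertices. *)
Lemma elimination_order S : exists s : seq V, [/\ uniq s, s =i S &
  {in s & &, forall w x y, (index x s < index w s)%N -> (index y s < index w s)%N ->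
     E w x -> E w y -> x != y -> E x y}].
Proof.
have [n] := ubnP #|S|; elim: n S => // n IH S ltn.
have [->|S0] := eqVneq S set0.
  by exists [::]; split=> // x; rewrite inE.
have [w wS sw] := simplicial_ex S0.
have [|s [us sS elim]] := IH (S :\ w).
  by move: ltn; rewrite (cardsD1 w) wS.
have ws : w \notin s by rewrite sS !inE eqxx.
exists (rcons s w); split.
- by rewrite rcons_uniq ws.
- by move=> x; rewrite mem_rcons in_cons sS !inE; case: eqVneq => // ->.
have idx x : index x (rcons s w) = if x \in s then index x s else (size s + (x != w))%N.
  by rewrite -cats1 index_cat; case: ifP => //= _; rewrite eq_sym; case: eqP.
move=> z x y zs xs ys; rewrite !idx.
have le u : u \in s -> (index u s < size s)%N by rewrite index_mem.
have inS u : u \in rcons s w -> u \in S.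
  by rewrite mem_rcons in_cons => /predU1P[->//|]; rewrite sS inE => /andP[].
have [zs'|zs'] := boolP (z \in s).
  have far m : (size s + m < index z s)%N = false.
    by apply/negbTE; rewrite -leqNgt (leq_trans (ltnW (le z zs'))) ?leq_addr.
  have [xs'|_] := boolP (x \in s); last by rewrite far.
  have [ys'|_] := boolP (y \in s); last by rewrite far.
  exact: elim.
have -> : z = w by move: zs; rewrite mem_rcons in_cons (negPf zs') orbF => /eqP.
by move=> _ _ Ewx Ewy; apply: sw => //; apply: inS.
Qed.

(** The earlier neighbour of [v] is the second vertex of an induced path within [B] from [v] to the
    first vertex of [B]. *)
Lemma chordal_peo : exists2 s : seq V, (forall v, v \in s) & peo E s.
Proof.
have [s [us sT elim]] := elimination_order [set: V].
have s_all v : v \in s by rewrite sT inE.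
exists s => // B v cB vB lt.
have [m mB em] := min_rank_ex s_all (B := B) ltac:(by apply/set0Pn; exists v).
have /connectP[p0 pth0 lst0] := connP _ _ cB v m vB mB.
have p0B : {subset p0 <= B}.
  elim: (p0) (v) pth0 => // y l IHl x /= /andP[/and3P[_ yB _] pl] z.
  by rewrite in_cons => /predU1P[->//|]; apply: IHl pl z.
have pth : path E v p0 by apply: sub_path pth0 => x y /and3P[].
have [q [sq lq cq]] := chordless_path pth.
rewrite -lst0 in lq.
case: q sq lq cq => [_ /= e|y l sq lq cq]; first by rewrite e em ltnn in lt.
(* A chordless path cannot have a local maximum, whose two neighbours would be
   adjacent; so a path starting upwards never comes down to m. *)
have up : forall l x y, chordless [:: x, y & l] -> (index x s < index y s)%N ->
    (index x s < index (last y l) s)%N.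
  elim=> //= z l' IHl x' y' /and3P[x'N /andP[Exy /andP[nExz _]] cyl] lt_xy.
  apply: (ltn_trans lt_xy); apply: IHl => //.
  move: cyl => /= /and3P[y'N /andP[Eyz _] _].
  case: ltngtP => // [lt_zy|e].
    case/negP: nExz; apply: (elim y' x' z (s_all _) (s_all _) (s_all _) lt_xy lt_zy _ Eyz).
      by rewrite symE.
    by move: x'N; rewrite !inE !negb_or => /and3P[].
  by move/(index_inj_all s_all): e y'N => ->; rewrite !inE eqxx.
exists y; split.
- by apply/p0B/sq; rewrite mem_head.
- case: ltngtP => // [lt_vy|e].
    have := up l v y cq lt_vy; rewrite /= in lq; rewrite lq em => lt'.
    by have := ltn_trans lt lt'; rewrite ltnn.
  by move/(index_inj_all s_all): e cq => -> /and3P[]; rewrite mem_head.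
- by move: cq => /and3P[_ /andP[]]; rewrite symE.
Qed.
End Chordal.

(** * Weighted partitions as lists *)

Lemma pser_signE (n : nat) (f : pser) nu : ((-1) ^+ n * f) nu = (-1) ^+ n * f nu.
Proof.
elim: n f => [|n IH] f; first by rewrite !mul1r.
by rewrite !exprS -!mulrA !mulN1r pserN IH.
Qed.

Section Decompositions.
Variable V : finType.
Implicit Types (L : seq {set V}) (kappa : wcomp) (t : seq (wblock V)).

Fixpoint decomps L kappa : seq (seq (wblock V)) :=
  if L is B :: L' then
    [seq (B, a) :: t | a <- subwc kappa, t <- decomps L' (msetB kappa a)]
  else if kappa == mset0 then [:: [::]] else [::].

Definition wtot t : wcomp := \big[msetD/mset0]_(p <- t) bwt p.

Lemma mem_decomps L kappa t :
  (t \in decomps L kappa) = ([seq bset p | p <- t] == L) && (wtot t == kappa).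
Proof.
elim: L kappa t => [|B L IH] kappa t.
  rewrite /= /wtot; case: t => [|p t]; last first.
    by rewrite /=; case: eqP; rewrite ?inE.
  by rewrite big_nil eq_sym /=; case: eqP; rewrite ?inE.
apply/allpairsPdep/andP => [[a [t' [+ + ->]]]|[/eqP eL /eqP]].
  rewrite mem_subwc IH => ak /andP[/eqP<- /eqP wt]; split=> //=.
  by rewrite /wtot big_cons /= -/(wtot t') wt msetBDKC.
case: t eL => [|[B' a] t'] //= [<- eL]; rewrite /wtot big_cons /= => <-.
exists a, t'; split=> //; first by rewrite mem_subwc msubset_addl.
by rewrite -[X in _ \in X]/(decomps L _) IH eL eqxx msetDKB /= /wtot eqxx.
Qed.

Lemma decomps_uniq L kappa : uniq (decomps L kappa).
Proof.
elim: L kappa => [|B L IH] kappa /=; first by case: eqP.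
apply: allpairs_uniq_dep => [|a _|]; rewrite ?subwc_uniq ?IH //.
by move=> [a t] [a' t'] _ _ /= [-> ->].
Qed.

(** This turns sums over weightings of fixed blocks into coefficients of products of series. *)
Lemma sum_decomps (F : {set V} -> pser) L kappa :
  \sum_(t <- decomps L kappa) \prod_(p <- t) F (bset p) (bwt p) =
  (\prod_(B <- L) F B) kappa.
Proof.
elim: L kappa => [|B L IH] kappa /=.
  by rewrite big_nil pser1E; case: eqP => _; rewrite ?big_seq1 big_nil.
rewrite big_allpairs_dep big_cons pserME; apply: eq_bigr => a _.
rewrite -IH mulr_sumr; apply: eq_bigr => t _; by rewrite big_cons.
Qed.
End Decompositions.

Section BlockSum.
Variables (V : finType) (E : rel V) (s : seq V).
Hypotheses (symE : symmetric E) (s_all : forall v, v \in s) (hpeo : peo E s).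
Implicit Types (B D Q : {set V}) (nu : wcomp) (t : seq (wblock V)).
Notation conn := (induces_connected E).
Notation min_rank := (min_rank s).
Notation b := (block_series E s).

(** The candidate for the Moebius symmetric function of the graph induced on [B]; its coefficients,
    taken in [block_mobius], are the candidate factors of the Moebius function. *)
Definition signed_series B : pser := (-1) ^+ #|B|.-1 * b B.
Definition block_mobius (p : wblock V) : int := signed_series (bset p) (bwt p).

Lemma block_mobiusE p : block_mobius p = (-1) ^+ #|bset p|.-1 * b (bset p) (bwt p).
Proof. exact: pser_signE. Qed.

(** By homogeneity of [b], weightings in which some block has the wrong weight size can be added to
    or dropped from a sum. *)
Lemma block_mobius_size p : bset p != set0 -> block_mobius p != 0 -> size (bwt p) = #|bset p|.-1.
Proof.
rewrite -card_gt0 => p0; rewrite block_mobiusE mulf_eq0 negb_or => /andP[_].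
exact: econe_homog (econe_block_series E s p0) _.
Qed.

Lemma prod_signed_series (L : seq {set V}) :
  \prod_(B <- L) signed_series B = (-1) ^+ (\sum_(B <- L) #|B|.-1)%N * \prod_(B <- L) b B.
Proof. by rewrite big_split /= -(big_morph _ (exprD _) (expr0 _)). Qed.

Lemma sum_card_plist B L : plist E s B L -> (\sum_(D <- L) #|D| = #|B|)%N.
Proof.
elim: L B => [|D L IH] B pl.
  rewrite big_nil; apply/esym/eqP; rewrite cards_eq0; apply/eqP/setP => v.
  by rewrite inE; apply/negP => /(plist_cover pl)[].
rewrite big_cons (IH _ (plist_cons pl)) cardsD (setIidPr _).
  by rewrite subnKC // subset_leq_card // (plist_sub pl) ?mem_head.
by rewrite (plist_sub pl) ?mem_head.
Qed.

Lemma sum_predn (I : eqType) (r : seq I) (F : I -> nat) :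
  {in r, forall i, 0 < F i}%N -> (\sum_(i <- r) (F i).-1 = \sum_(i <- r) F i - size r)%N.
Proof.
move=> F0; rewrite -sum1_size.
have -> : (\sum_(i <- r) F i = \sum_(i <- r) (F i).-1 + \sum_(i <- r) 1)%N.
  rewrite -big_split big_seq [RHS]big_seq; apply: eq_bigr => i /F0 Fi.
  by rewrite /= addn1 prednK.
by rewrite addnK.
Qed.

(* Weightings of total at most nu of the connected partitions of Q, as lists sorted
   by decreasing rank; block_mobius vanishes on blocks of the wrong weight size, which are
   therefore not excluded here. *)
Definition wlists Q nu : seq (seq (wblock V)) :=
  [seq t | La <- [seq (L, kappa) | L <- cut_lists E s #|Q| Q (size s), kappa <- subwc nu],
           t <- decomps La.1 La.2].

Lemma mem_wlists Q nu t : conn Q -> Q != set0 ->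
  t \in wlists Q nu <-> plist E s Q [seq bset p | p <- t] /\ msubset (wtot t) nu.
Proof.
move=> cQ Q0; have lt_s L : plist E s Q L ->
    (if L is D :: _ :: _ then min_rank D < size s else true)%N.
  by case: L => [|D [|D' L]] // pl; rewrite min_rank_lt // (plist_neq0 pl) ?mem_head.
split.
  case/allpairsPdep=> [[L kappa] [t' [/allpairsP[[L' k'] /= [LP kP [-> ->]]] + ->]]].
  rewrite mem_decomps => /andP[/eqP-> /eqP->]; rewrite -mem_subwc; split=> //.
  by have /(mem_cut_lists symE s_all _ _ hpeo cQ Q0 (leqnn _))[] := LP.
case=> pl; rewrite -mem_subwc => wt; apply/allpairsPdep.
exists ([seq bset p | p <- t], wtot t), t; split=> //; last by rewrite mem_decomps !eqxx.
apply/allpairsP; exists ([seq bset p | p <- t], wtot t); split=> //.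
apply/(mem_cut_lists symE s_all _ _ hpeo cQ Q0 (leqnn _)).
by split=> //=; have := lt_s _ pl; case: [seq bset p | p <- t] => [|D []].
Qed.

Lemma wlists_uniq Q nu : uniq (wlists Q nu).
Proof.
apply: allpairs_uniq_dep => [|La _|]; first 1 last.
- exact: decomps_uniq.
- move=> [[L k] t] [[L' k'] t'] /=.
  move=> /allpairsPdep[[L1 k1] [t1 [_ m1 /= e1]]].
  move=> /allpairsPdep[[L2 k2] [t2 [_ m2 /= e2]]] /= e.
  move: e1 e2 m1 m2 e => [-> -> ->] [-> -> ->]; rewrite !mem_decomps /=.
  by move=> /andP[/eqP<- /eqP<-] /andP[/eqP<- /eqP<-] ->.
apply: allpairs_uniq; rewrite ?cut_lists_uniq ?subwc_uniq //.
by move=> [L k] [L' k'] _ _ /= [-> ->].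
Qed.

(** The blocks of [L] use a weight of size [#|Q| - size L], and what remains of [nu] is an arbitrary
    multiset of size [size L - 1]. Summing over weightings is thus multiplication by
    [hsym (size L).-1], and [sum_cut_lists0] applies once the signs are collected. *)
Lemma sum_wlists Q nu : conn Q -> (1 < #|Q|)%N -> size nu = #|Q|.-1 ->
  \sum_(t <- wlists Q nu) \prod_(p <- t) block_mobius p = 0.
Proof.
move=> cQ Q1 snu; have Q0 : Q != set0 by rewrite -card_gt0 ltnW.
rewrite big_allpairs_dep big_allpairs_dep /=.
transitivity (((-1) ^+ #|Q|.-1 * \sum_(L <- cut_lists E s #|Q| Q (size s))
   (-1) ^+ (size L).-1 * hsym (size L).-1 * \prod_(D <- L) b D) nu); last first.
  rewrite sum_cut_lists0 ?mulr0 // => D D0 _; exact: min_rank_lt.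
rewrite mulr_sumr pser_sum; apply: eq_big_seq => L LP.
have /(mem_cut_lists symE s_all _ _ hpeo cQ Q0 (leqnn _))[pl _] := LP.
have L0 : {in L, forall D, 0 < #|D|}%N by move=> D /(plist_neq0 pl); rewrite card_gt0.
have szL := cut_lists_neq0 LP.
have sumL := sum_predn L0; rewrite (sum_card_plist pl) in sumL.
have leL : (size L <= #|Q|)%N.
  rewrite -(sum_card_plist pl) -sum1_size big_seq [leqRHS]big_seq; exact: leq_sum.
have hom : homog (\sum_(D <- L) #|D|.-1) (\prod_(D <- L) signed_series D).
  apply: (homog_prod (d := fun D => #|D|.-1)) => D /L0 D0 kap.
  rewrite /signed_series pser_signE mulf_eq0 negb_or => /andP[_].
  exact: econe_homog (econe_block_series E s D0) _.
transitivity ((\prod_(D <- L) signed_series D * hsym (size L).-1) nu).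
  rewrite pserME; apply: eq_big_seq => kappa; rewrite mem_subwc => knu.
  rewrite (sum_decomps signed_series); have [->|nz] := eqVneq ((\prod_(D <- L) signed_series D) kappa) 0.
    by rewrite mul0r.
  rewrite /hsym size_msetB // (hom _ nz) sumL snu.
  have -> : (#|Q|.-1 - (#|Q| - size L) == (size L).-1)%N by apply/eqP; lia.
  by rewrite mulr1.
apply: (congr1 (fun f : pser => f nu)); rewrite prod_signed_series sumL.
have -> : (#|Q| - size L = #|Q|.-1 - (size L).-1)%N.
  by rewrite -{1}(prednK szL) subnS predn_sub.
have sgn (a c : nat) : (c <= a)%N -> (-1) ^+ (a - c) = (-1) ^+ a * (-1) ^+ c :> pser.
  by move=> ca; rewrite -[in RHS](subnK ca) exprD -mulrA -expr2 sqrr_sign mulr1.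
rewrite sgn; last by lia.
by rewrite -!mulrA; congr (_ * (_ * _)); rewrite mulrC.
Qed.
End BlockSum.

(** * The Moebius function *)

Section WPartitions.
Variables (V : finType) (E : rel V).
Implicit Types (pi rho sigma : gpartition E) (p q : wblock V).

Lemma is_wpartition_intro (tau : {fset wblock V}) :
  (forall p, p \in tau -> bset p != set0) ->
  (forall v, exists2 p, p \in tau & v \in bset p) ->
  (forall p q v, p \in tau -> q \in tau -> v \in bset p -> v \in bset q -> p = q) ->
  (forall p, p \in tau -> size (bwt p) = #|bset p|.-1) -> is_wpartition tau.
Proof.
move=> n0 cov dj sz; apply/and3P; split.
- rewrite map_inj_in_uniq ?fset_uniq // => p q pt qt e.
  have /set0Pn[v vp] := n0 p pt; apply: (dj p q v) => //; by rewrite -e.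
- apply/and3P; split.
  + apply/eqP/setP => v; rewrite inE; apply/bigcupP; have [p pt vp] := cov v.
    by exists (bset p) => //; rewrite inE map_f.
  + apply/trivIsetP => A B; rewrite !inE => /mapP[p pt ->] /mapP[q qt ->].
    apply: contraR => /pred0Pn[v /= /andP[vp vq]]; by rewrite (dj p q v).
  + by rewrite inE; apply/mapP => -[p /n0 + e]; rewrite -e eqxx.
- by apply/allP => p pt; apply/eqP/sz.
Qed.

Lemma wblock_size (pi : wpartition V) p : p \in wblocks pi ->
  size (bwt p) = #|bset p|.-1.
Proof. by case: pi => tau /= /and3P[_ _ /allP sz] /sz/eqP. Qed.

Lemma gblock_conn pi p : p \in wblocks pi -> induces_connected E (bset p).
Proof. by case: pi => w /= /allP; apply. Qed.

Lemma gpartition_eq pi rho : wblocks pi =i wblocks rho -> pi = rho.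
Proof. by move=> e; do 2!apply: val_inj; apply/fsetP. Qed.

Lemma gpartition_ex (tau : {fset wblock V}) : is_wpartition tau ->
  (forall p, p \in tau -> induces_connected E (bset p)) ->
  exists pi : gpartition E, wblocks pi = tau.
Proof.
move=> w /allP c; by exists (@GPartition _ E (WPartition w) c).
Qed.

Lemma gle_sub pi rho p q v : (pi <= rho)%O -> p \in wblocks pi -> q \in wblocks rho ->
  v \in bset p -> v \in bset q -> bset p \subset bset q.
Proof.
move=> /wpartition_leP[+ _] pP qR vp vq => /(_ p pP)[q' q'R pq'].
by rewrite (wblock_inj qR q'R vq (fintype.subsetP pq' _ vp)).
Qed.

Lemma finite_gle pi : finite_set [set sigma | (sigma <= pi)%O]%classic.
Proof.
have := finite_gpartition_itv (\bot%O : gpartition E) pi.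
apply: sub_finite_set => sigma /= le; apply/andP; split=> //; exact: le0x.
Qed.

Definition below pi : seq (gpartition E) := fset_set [set sigma | (sigma <= pi)%O]%classic.

Lemma mem_below pi sigma : (sigma \in below pi) = (sigma <= pi)%O.
Proof.
rewrite /below in_fset_set; last exact: finite_gle.
by apply/idP/idP => [/set_mem|/mem_set].
Qed.

Lemma below_uniq pi : uniq (below pi). Proof. exact: fset_uniq. Qed.

Lemma size_below_lt pi rho : (pi < rho)%O -> (size (below pi) < size (below rho))%N.
Proof.
move=> lt; have : {subset rho :: below pi <= below rho}.
  move=> x; rewrite in_cons => /predU1P[->|]; rewrite !mem_below //.
  by move/le_trans; apply; apply: ltW.
apply: uniq_leq_size; rewrite /= below_uniq andbT mem_below.
by rewrite lt_geF.
Qed.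

(** The vanishing sums determine the value at [pi] from those strictly below it, by induction on the
    size of the lower set. *)
Lemma mobius_uniq (m : gpartition E -> int) : m \bot%O = 1 ->
  (forall pi, pi != \bot%O -> \sum_(sigma <- below pi) m sigma = 0) ->
  forall pi, mobius \bot%O pi = m pi.
Proof.
move=> m0 msum pi; have [n] := ubnP (size (below pi)); elim: n pi => // n IH pi ltn.
have [->|pi0] := eqVneq pi \bot%O; first by rewrite mobius_xx.
have fin := finite_gpartition_itv (\bot%O : gpartition E) pi.
rewrite mobius_lt // ?lt0x //; apply/eqP; rewrite eq_sym -addr_eq0; apply/eqP.
rewrite -[RHS](msum pi pi0) [RHS](bigD1_seq pi) ?below_uniq ?mem_below //=.
congr (_ + _); rewrite (eq_fsbigr m); last first.
  move=> x /set_mem /= /andP[_ /size_below_lt lt]; apply: IH.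
  by apply: leq_trans lt _; rewrite -ltnS.
rewrite -[RHS]big_filter; apply: (fsbig_fwiden [seq i <- below pi | i != pi]).
- move=> x /= /andP[_ lt]; rewrite mem_filter mem_below (ltW lt) andbT.
  by rewrite lt_neqAle in lt; case/andP: lt.
- by rewrite filter_uniq ?below_uniq.
- move=> x /= [+ nx]; rewrite mem_filter mem_below => /andP[ne le].
  by case: nx; rewrite le0x lt_neqAle ne.
Qed.
End WPartitions.

Section MobiusValue.
Variables (V : finType) (E : rel V) (s : seq V).
Hypotheses (symE : symmetric E) (s_all : forall v, v \in s) (hpeo : peo E s).
Implicit Types (pi rho sigma : gpartition E) (p q : wblock V) (Q : {set V}).
Implicit Types (r t : seq (wblock V)).
Notation conn := (induces_connected E).
Notation min_rank := (min_rank s).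
Notation b := (block_series E s).
Notation block_mobius := (block_mobius E s).

Definition rank_gt : rel (wblock V) := fun p q => (min_rank (bset q) < min_rank (bset p))%N.
(** Puts a set of blocks in the canonical order that [plist] prescribes. *)
Definition slist r := sort (fun p q => min_rank (bset q) <= min_rank (bset p))%N r.

Lemma mem_slist r : slist r =i r. Proof. exact: mem_sort. Qed.

Lemma slist_sorted r : uniq r ->
  {in r &, forall p q, min_rank (bset p) = min_rank (bset q) -> p = q} -> sorted rank_gt (slist r).
Proof.
move=> ur inj; have : sorted gtn [seq min_rank (bset p) | p <- slist r].
  rewrite gtn_sorted_uniq_geq; apply/andP; split.
    rewrite map_inj_in_uniq ?sort_uniq // => p q; rewrite !mem_slist; exact: inj.
  rewrite sorted_map; apply: sort_sorted => p q; exact: leq_total.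
by rewrite sorted_map.
Qed.

Lemma slist_eq r t : uniq r ->
  {in r &, forall p q, min_rank (bset p) = min_rank (bset q) -> p = q} ->
  sorted rank_gt t -> t =i r -> slist r = t.
Proof.
move=> ur inj st e; apply: (irr_sorted_eq (leT := rank_gt)) => //.
- by move=> q p p'; rewrite /rank_gt => h1 h2; apply: ltn_trans h2 h1.
- by move=> p; rewrite /rank_gt ltnn.
- exact: slist_sorted.
- by move=> p; rewrite mem_slist e.
Qed.

Lemma wblock_min_rank_inj pi p q : p \in wblocks pi -> q \in wblocks pi ->
  min_rank (bset p) = min_rank (bset q) -> p = q.
Proof.
move=> pP qP e; have [v vp ev] := min_rank_ex s_all (wblock_neq0 pP).
have [u uq eu] := min_rank_ex s_all (wblock_neq0 qP).
apply: (wblock_inj pP qP vp); suff -> : v = u by [].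
by apply: (index_inj_all s_all); rewrite ev e eu.
Qed.

Definition mobius_prod pi : int := \prod_(p <- wblocks pi) block_mobius p.

Lemma block_series1 v : b [set v] = 1.
Proof.
rewrite -(block_seriesE E s 0) ?cards1 // gammaE ?cards1 // eqxx big1 => [|D cut].
  by rewrite addr0 mulr1n lin_evalC elem_sym0 mulr1.
have [D0 BD0] := cuttable_gt0 cut.
have [cD _] := cuttable_card cut; rewrite cards1 in cD; lia.
Qed.

Lemma mobius_prod_bottom : mobius_prod \bot%O = 1.
Proof.
rewrite /mobius_prod big_seq big1 // => p /in_bottom_blocks[v ->].
by rewrite block_mobiusE /= cards1 block_series1 pser1E eqxx mulr1.
Qed.

(** Here [Q] is meant to be a block of a coarser partition or the whole vertex set. The inner blocks
    form a sorted list, to be matched with [wlists]; the outer ones form a set, which indexes the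
    fibres of the sum. *)
Definition inside Q pi := slist [seq p <- wblocks pi | bset p \subset Q].
Definition outside Q pi := [fset p in wblocks pi | ~~ (bset p \subset Q)]%fset.

Lemma mem_inside Q pi p : (p \in inside Q pi) = (p \in wblocks pi) && (bset p \subset Q).
Proof. by rewrite mem_slist mem_filter andbC. Qed.

Lemma mem_outside Q pi p : 
  (p \in outside Q pi) = (p \in wblocks pi) && ~~ (bset p \subset Q).
Proof. by rewrite !finmap.inE. Qed.

Lemma mobius_prod_split Q pi :
  mobius_prod pi = \prod_(p <- outside Q pi) block_mobius p * \prod_(p <- inside Q pi) block_mobius p.
Proof.
rewrite /mobius_prod (bigID (fun p => bset p \subset Q)) /= mulrC; congr (_ * _); rewrite -big_filter.
  apply: perm_big; apply: uniq_perm; rewrite ?filter_uniq ?fset_uniq // => p.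
  by rewrite mem_filter mem_outside andbC.
by apply: perm_big; rewrite perm_sym perm_sort.
Qed.

Lemma inside_sorted Q pi : sorted rank_gt (inside Q pi).
Proof.
apply: slist_sorted; first by rewrite filter_uniq ?fset_uniq.
move=> p q; rewrite !mem_filter => /andP[_ pP] /andP[_ qP]; exact: (wblock_min_rank_inj pP qP).
Qed.

Lemma inside_plist Q pi :
  (forall v, v \in Q -> exists p, [/\ p \in wblocks pi, v \in bset p & bset p \subset Q]) ->
  plist E s Q [seq bset p | p <- inside Q pi].
Proof.
move=> cov; split.
- rewrite sorted_map; exact: inside_sorted.
- by move=> _ /mapP[p + ->]; rewrite mem_inside => /andP[/wblock_neq0].
- by move=> _ /mapP[p + ->]; rewrite mem_inside => /andP[/gblock_conn].
- by move=> _ /mapP[p + ->]; rewrite mem_inside => /andP[].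
- move=> v /cov[p [pP vp pQ]]; exists (bset p) => //.
  by apply: map_f; rewrite mem_inside pP.
- move=> _ _ v /mapP[p + ->] /mapP[q + ->]; rewrite !mem_inside.
  move=> /andP[pP _] /andP[qP _] vp vq; by rewrite (wblock_inj pP qP vp vq).
Qed.

(* Once the blocks of sigma outside one block q0 of pi are fixed, the inner ones
   range over all weighted partitions of q0. *)
Section OneBlock.
Variables (pi sigma0 : gpartition E) (q0 : wblock V).
Hypotheses (q0_pi : q0 \in wblocks pi) (le0 : (sigma0 <= pi)%O).
Let Q := bset q0.
Let nu := bwt q0.
Let rho := outside Q sigma0.
Let good t := all (fun p => size (bwt p) == #|bset p|.-1) t.

Let sub_out p v : p \in rho -> v \in bset p -> v \notin Q.
Proof.
rewrite mem_outside => /andP[pP npQ] vp; apply: contraNN npQ => vQ.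
exact: (gle_sub le0 pP q0_pi vp).
Qed.

(** Half of the bijection between the fibre of [outside Q] over [rho] and the [good] lists; the
    bound on the total weight is the one imposed by [q0]. *)
Lemma inside_wlists sigma : (sigma <= pi)%O ->
  inside Q sigma \in wlists E s Q nu /\ good (inside Q sigma).
Proof.
move=> le; split; last first.
  by apply/allP => p; rewrite mem_inside => /andP[/wblock_size-> _].
apply/(mem_wlists symE s_all hpeo).
- exact: gblock_conn q0_pi.
- exact: wblock_neq0 q0_pi.
split.
  apply: inside_plist => v vQ; have [p pP vp] := wblock_exists sigma v.
  by exists p; split=> //; apply: (gle_sub le pP q0_pi vp).
apply/msubsetP => i; rewrite /wtot big_msetDE.
have /wpartition_leP[_ /(_ q0 i q0_pi)] := le; apply: leq_trans.
rewrite (perm_big [seq p <- wblocks sigma | bset p \subset Q]) ?perm_sort //.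
by rewrite big_filter.
Qed.

(** The other half: the preimage keeps the outer blocks of [sigma0] and replaces the inner ones by
    [t]. *)
Lemma wlists_inside t : t \in wlists E s Q nu -> good t ->
  exists sigma, [/\ (sigma <= pi)%O, outside Q sigma = rho & inside Q sigma = t].
Proof.
have cQ : conn Q := gblock_conn q0_pi; have Q0 : Q != set0 := wblock_neq0 q0_pi.
move=> /(mem_wlists symE s_all hpeo _ _ cQ Q0)[pl wt] /allP gt.
have [srt n0 cn sub cov dj] := pl.
have inj p q v : p \in t -> q \in t -> v \in bset p -> v \in bset q -> p = q.
  move=> pt qt vp vq; have e : bset p = bset q by apply: (dj _ _ v) => //; apply: map_f.
  apply: (@uniq_map_inj _ _ (fun p : wblock V => bset p) t) => //.
  apply: (sorted_uniq (leT := fun D D' => min_rank D' < min_rank D)%N) => //.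
  - by move=> D2 D1 D3 h1 h2; apply: ltn_trans h2 h1.
  - by move=> D; rewrite ltnn.
have subt p : p \in t -> bset p \subset Q by move=> pt; apply: sub; apply: map_f.
have n0t p : p \in t -> bset p != set0 by move=> pt; apply: n0; apply: map_f.
pose tau : {fset wblock V} := (rho `|` [fset p in t])%fset.
have tauE p : (p \in tau) = (p \in rho) || (p \in t) by rewrite !finmap.inE.
have rho0 p : p \in rho -> p \in wblocks sigma0 by rewrite mem_outside => /andP[].
have wtau : is_wpartition tau.
  apply: is_wpartition_intro.
  - by move=> p; rewrite tauE => /orP[/rho0/wblock_neq0|/n0t].
  - move=> v; have [vQ|vQ] := boolP (v \in Q).
      have [D] := cov v vQ; case/mapP=> p pt -> vp.
      by exists p; rewrite // tauE pt orbT.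
    have [p pP vp] := wblock_exists sigma0 v; exists p => //.
    rewrite tauE mem_outside pP; apply/orP; left => /=.
    by apply: contraNN vQ => /fintype.subsetP; apply.
  - move=> p q v; rewrite !tauE => /orP[pr|pt] /orP[qr|qt] vp vq.
    + by apply: (wblock_inj (rho0 p pr) (rho0 q qr) vp vq).
    + by have := sub_out pr vp; rewrite (fintype.subsetP (subt q qt)).
    + by have := sub_out qr vq; rewrite (fintype.subsetP (subt p pt)).
    + exact: inj vp vq.
  - by move=> p; rewrite tauE => /orP[/rho0/wblock_size|/gt/eqP].
have [|sigma es] := gpartition_ex wtau (E := E).
  by move=> p; rewrite tauE => /orP[/rho0/gblock_conn//|pt]; apply: cn; apply: map_f.
have mem_s p : (p \in wblocks sigma) = (p \in rho) || (p \in t) by rewrite es tauE.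
have ut : uniq t.
  apply: (map_uniq (f := fun p : wblock V => bset p)).
  apply: (sorted_uniq (leT := fun D D' => min_rank D' < min_rank D)%N) => //.
  - by move=> D2 D1 D3 h1 h2; apply: ltn_trans h2 h1.
  - by move=> D; rewrite ltnn.
have filt : [seq p <- wblocks sigma | bset p \subset Q] =i t.
  move=> p; rewrite mem_filter mem_s mem_outside.
  case: (boolP (p \in t)) => [/subt->|_]; first by rewrite orbT.
  by rewrite orbF; case: (bset p \subset Q); rewrite ?andbF.
exists sigma; split.
- have /wpartition_leP[le1 le2] := le0; apply/wpartition_leP; split.
    move=> p; rewrite mem_s => /orP[/rho0/le1//|pt].
    by exists q0 => //; apply: subt.
  (* At [q0] the bound is the one on the total of [t]. Any other block of [pi] is disjoint from [Q]
     and contains the same blocks of [sigma] as of [sigma0]. *)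
  move=> q i qP; have [eq|nq] := eqVneq q q0.
    rewrite eq -big_filter (perm_big t); last first.
      by apply: uniq_perm => //; rewrite filter_uniq ?fset_uniq.
    by rewrite -big_msetDE; apply/msubsetP.
  have noQ p v : v \in bset p -> bset p \subset Q -> bset p \subset bset q -> False.
    move=> vp pQ pq; case/eqP: nq; apply: (wblock_inj qP q0_pi (v := v)).
      exact: (fintype.subsetP pq).
    exact: (fintype.subsetP pQ).
  apply: leq_trans (le2 q i qP); rewrite -big_filter -[leqRHS]big_filter.
  rewrite (perm_big [seq p <- wblocks sigma0 | bset p \subset bset q]) //.
  apply: uniq_perm; rewrite ?filter_uniq ?fset_uniq // => p.
  rewrite !mem_filter; have [pq|] //= := boolP (bset p \subset bset q).
  rewrite mem_s mem_outside; have [pQ|] := boolP (bset p \subset Q).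
    rewrite andbF /=; apply/idP/idP => [/n0t/set0Pn[v vp]|/wblock_neq0/set0Pn[v vp]].
      by case: (noQ p v).
    by case: (noQ p v).
  rewrite andbT => npQ; case: (boolP (p \in t)) => [/subt pQ|]; last by rewrite orbF.
  by rewrite pQ in npQ.
- apply/fsetP => p; rewrite mem_outside mem_s; apply/andP/idP => [[/orP[//|/subt->]]|] //.
  move=> pr; rewrite pr; split=> //; by move: pr; rewrite mem_outside => /andP[].
- apply: slist_eq.
  + by rewrite filter_uniq ?fset_uniq.
  + move=> p q; rewrite !mem_filter => /andP[_ pP] /andP[_ qP]; exact: (wblock_min_rank_inj pP qP).
  + by rewrite sorted_map in srt.
  + by move=> p; rewrite filt.
Qed.

(** The outer blocks contribute a common factor, and the inner ones run through the lists summed to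
    zero in [sum_wlists]. *)
Lemma sum_fiber : (1 < #|Q|)%N ->
  \sum_(sigma <- below pi | outside Q sigma == rho) mobius_prod sigma = 0.
Proof.
move=> Q1.
(* A list with a block of the wrong weight size has product zero, so the full sum reduces to the
   [good] lists. *)
have e : \sum_(t <- wlists E s Q nu | good t) \prod_(p <- t) block_mobius p = 0.
  rewrite -[RHS](sum_wlists symE s_all hpeo (gblock_conn q0_pi) Q1 (wblock_size q0_pi)).
  rewrite big_mkcond; apply: eq_big_seq => t; case: ifPn => // /allPn[p pt sz].
  move/(mem_wlists symE s_all hpeo _ _ (gblock_conn q0_pi) (wblock_neq0 q0_pi)) => [pl _].
  rewrite (big_rem p) //=; have [->|nz] := eqVneq (block_mobius p) 0; first by rewrite mul0r.
  by rewrite (block_mobius_size _ nz) ?eqxx // in sz; apply: (plist_neq0 pl); apply: map_f.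
under eq_bigr => sigma /eqP er do rewrite (mobius_prod_split Q) er.
rewrite -mulr_sumr; set S := (X in _ * X).
pose fib := [seq sigma <- below pi | outside Q sigma == rho].
have -> : S = \sum_(t <- map (inside Q) fib) \prod_(p <- t) block_mobius p
  by rewrite big_map big_filter.
rewrite (perm_big [seq t <- wlists E s Q nu | good t]) ?big_filter ?e ?mulr0 //.
apply: uniq_perm; rewrite ?filter_uniq ?wlists_uniq //.
  rewrite map_inj_in_uniq ?filter_uniq ?below_uniq // => sigma sigma'.
  rewrite !mem_filter => /andP[/eqP e1 _] /andP[/eqP e2 _] ei.
  apply: gpartition_eq => p; have := mem_inside Q sigma p; have := mem_inside Q sigma' p.
  have := mem_outside Q sigma p; have := mem_outside Q sigma' p; rewrite e1 e2 ei.
  by case: (bset p \subset Q); rewrite ?andbT ?andbF /=; [move=> _ _ <- <-|move=> <- <-].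
move=> t; apply/mapP/idP => [[sigma + ->]|].
  rewrite !mem_filter mem_below => /andP[_ /inside_wlists[-> ->]] //.
rewrite mem_filter => /andP[gt tw]; have [sigma [le eo ei]] := wlists_inside tw gt.
by exists sigma; rewrite // mem_filter eo eqxx mem_below.
Qed.
End OneBlock.

(** An element other than the bottom has a block with at least two vertices, since singletons carry
    no weight. The sum is split according to the blocks outside this block, and each fibre sums to
    zero. *)
Lemma sum_mobius_prod_below pi : pi != \bot%O -> \sum_(sigma <- below pi) mobius_prod sigma = 0.
Proof.
move=> pi0; have [q qP Q1] : exists2 q, q \in wblocks pi & (1 < #|bset q|)%N.
  have [/hasP[q qP Q1]|/hasPn no] := boolP (has (fun q => 1 < #|bset q|)%N (wblocks pi)).
    by exists q.
  case/eqP: pi0.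
  have sub q : q \in wblocks pi -> q \in bottom_blocks.
    move=> qP; have := no q qP; have := wblock_neq0 qP; rewrite -leqNgt -card_gt0 => h1 h2.
    have /eqP/cards1P[v ev] : #|bset q| = 1%N by lia.
    have := wblock_size qP; rewrite ev cards1 /= => /eqP; rewrite size_mset_eq0 => /eqP ew.
    have -> : q = ([set v], mset0) by rewrite -ev -ew; case: (q).
    exact: bottom_blocksE.
  apply: gpartition_eq => q; apply/idP/idP => [/sub//|qb].
  have [v eq] := in_bottom_blocks qb; have [q' q'P vq'] := wblock_exists pi v.
  have [u eu] := in_bottom_blocks (sub q' q'P).
  by rewrite eu /= inE in vq'; rewrite eq (eqP vq') -eu.
rewrite /below (partition_big_imfset _ (outside (bset q))) /= big_seq big1 // => rho.
case/imfsetP => sigma0 /= sB ->; apply: sum_fiber => //.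
by rewrite -mem_below.
Qed.

Lemma mobiusE pi : mobius \bot%O pi = mobius_prod pi.
Proof. exact: (mobius_uniq mobius_prod_bottom sum_mobius_prod_below). Qed.
End MobiusValue.

(** * Maximal elements *)

Section Components.
Variables (V : finType) (E : rel V) (s : seq V).
Hypotheses (symE : symmetric E) (s_all : forall v, v \in s) (hpeo : peo E s).
Implicit Types (pi rho sigma : gpartition E) (p q : wblock V) (B Q : {set V}).
Notation conn := (induces_connected E).
Notation min_rank := (min_rank s).

Definition component v : {set V} := [set u | connect E v u].

Definition comps := sort (fun B D => min_rank D <= min_rank B)%N
  [seq component r | r <- enum (fingraph.roots E)].

Lemma component_conn v : conn (component v).
Proof.
have csym := sym_connect_sym symE.
apply/(connP E) => x y; rewrite !inE => vx vy.
have /connectP[p] : connect E x y by apply: connect_trans vy; rewrite csym.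
move=> pth ->; elim: p x vx pth => //= z p IH x vx /andP[Exz pth].
have vz := connect_trans vx (connect1 Exz).
apply: connect_trans (IH z vz pth); apply: connect1.
by rewrite /relin /= !inE vx vz.
Qed.

Lemma conn_sub_component B v : conn B -> v \in B -> B \subset component v.
Proof.
move=> /(connP E) cB vB; apply/subsetP => u uB; rewrite inE.
apply: connect_sub (cB v u vB uB) => x y /and3P[_ _ Exy]; exact: connect1.
Qed.

Lemma component_eq u v : u \in component v -> component u = component v.
Proof.
rewrite inE => vu; apply/setP => w; rewrite !inE.
by rewrite (same_connect (sym_connect_sym symE) vu).
Qed.

Lemma mem_comps v : component v \in comps.
Proof.
rewrite mem_sort; apply/mapP; exists (fingraph.root E v).
  by rewrite mem_enum; apply: roots_root; apply: sym_connect_sym.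
by apply/esym/component_eq; rewrite inE connect_root.
Qed.

Lemma compsP B : B \in comps -> exists v, B = component v.
Proof. by rewrite mem_sort => /mapP[v _ ->]; exists v. Qed.

Lemma comps_eq B v : B \in comps -> v \in B -> B = component v.
Proof. by move=> /compsP[u ->] /component_eq->. Qed.

Lemma comps_neq0 B : B \in comps -> B != set0.
Proof. by case/compsP => v ->; apply/set0Pn; exists v; rewrite inE connect0. Qed.

Lemma comps_min_rank_inj : {in comps &, injective min_rank}.
Proof.
move=> B D BC DC e; have [v vB ev] := min_rank_ex s_all (comps_neq0 BC).
have [u uD eu] := min_rank_ex s_all (comps_neq0 DC).
have euv : u = v by apply: (index_inj_all s_all); rewrite ev eu e.
by rewrite (comps_eq BC vB) (comps_eq DC uD) euv.
Qed.

Lemma comps_uniq : uniq comps.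
Proof.
rewrite sort_uniq map_inj_in_uniq ?enum_uniq // => u v.
rewrite !mem_enum => /eqP ru /eqP rv /setP/(_ v); rewrite !inE connect0 => /idP uv.
by rewrite -ru -rv; apply/eqP; rewrite root_connect //; apply: sym_connect_sym.
Qed.

Lemma size_comps : size comps = n_comp E V.
Proof.
rewrite size_sort size_map -cardE; apply: eq_card => v.
by rewrite !inE andbT.
Qed.

Lemma comps_plist : plist E s [set: V] comps.
Proof.
split.
- have : sorted gtn [seq min_rank B | B <- comps].
    rewrite gtn_sorted_uniq_geq map_inj_in_uniq ?comps_uniq /=; last exact: comps_min_rank_inj.
    rewrite sorted_map; apply: sort_sorted => B D; exact: leq_total.
  by rewrite sorted_map.
- exact: comps_neq0.
- by move=> _ /compsP[v ->]; apply: component_conn.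
- by move=> B _; apply: subsetT.
- by move=> v _; exists (component v); rewrite ?mem_comps // inE connect0.
- by move=> B D v BC DC vB vD; rewrite (comps_eq BC vB) (comps_eq DC vD).
Qed.

Lemma maximal_comps pi p : maximal pi -> p \in wblocks pi -> bset p \in comps.
Proof.
move=> mx pP.
have cov B : B \in comps -> forall v, v \in B ->
    exists p, [/\ p \in wblocks pi, v \in bset p & bset p \subset B].
  move=> BC v vB; have [q qP vq] := wblock_exists pi v; exists q; split=> //.
  rewrite (comps_eq BC vB); exact: conn_sub_component (gblock_conn qP) vq.
(* Merging the blocks of pi inside each component, padded by the first variable,
   gives an element above pi. *)
pose w B : wcomp := msetD (wtot (inside s B pi)) (msetn (size (inside s B pi)).-1 0%N).
have pl B : B \in comps -> plist E s B [seq bset p | p <- inside s B pi].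
  by move=> BC; apply: inside_plist => //; apply: cov.
pose tau : {fset wblock V} := [fset (B, w B) | B in comps]%fset.
have tauP q : q \in tau -> bset q \in comps /\ bwt q = w (bset q).
  by case/imfsetP => B /= BC ->.
have tauI B : B \in comps -> (B, w B) \in tau by move=> BC; apply/imfsetP; exists B.
have tau_w : is_wpartition tau.
  apply: is_wpartition_intro.
  - by move=> q /tauP[/comps_neq0].
  - move=> v; exists (component v, w (component v)); rewrite ?inE ?connect0 //.
    exact/tauI/mem_comps.
  - move=> q q' v /tauP[qC wq] /tauP[q'C wq'] vq vq'.
    have e : bset q = bset q' by rewrite (comps_eq qC vq) (comps_eq q'C vq').
    by move: e wq wq'; case: q q' {qC q'C vq vq'} => [B a] [B' a'] /= -> -> ->.
  - move=> q /tauP[qC ->]; move: (bset q) qC => B BC.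
    (* If [B] is made of [m] blocks, their weights have total size [#|B| - m], and the padding adds
       the missing [m - 1]. *)
    rewrite /w size_msetD enum_msetn size_nseq /wtot size_big_msetD.
    have -> : (\sum_(p0 <- inside s B pi) size (bwt p0)
       = \sum_(p0 <- inside s B pi) #|bset p0|.-1)%N.
      by apply: eq_big_seq => p'; rewrite mem_inside => /andP[/wblock_size].
    rewrite sum_predn => [|p']; last first.
      by rewrite mem_inside card_gt0 => /andP[/wblock_neq0].
    have := sum_card_plist (pl B BC); rewrite big_map => ->.
    have le : (size (inside s B pi) <= #|B|)%N.
      rewrite -(sum_card_plist (pl B BC)) big_map -sum1_size big_seq [leqRHS]big_seq.
      by apply: leq_sum => p'; rewrite mem_inside card_gt0 => /andP[/wblock_neq0].
    have : (0 < size (inside s B pi))%N.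
    2: by move=> sz; rewrite -[(size _).-1]subn1 addnBA // subnK // subn1.
    have /set0Pn[v vB] := comps_neq0 BC; have [p' [p'P vp' p'B]] := cov B BC v vB.
    have : p' \in inside s B pi by rewrite mem_inside p'P.
    by case: (inside s B pi).
have [|rho er] := gpartition_ex tau_w (E := E).
  by move=> q /tauP[/compsP[v ->] _]; apply: component_conn.
have le : (pi <= rho)%O.
  apply/wpartition_leP; split=> [q qP|q i].
    have /set0Pn[v vq] := wblock_neq0 qP.
    exists (component v, w (component v)); first by rewrite er; apply/tauI/mem_comps.
    exact: conn_sub_component (gblock_conn qP) vq.
  rewrite er => /tauP[qC ->]; rewrite /w msetE2 /wtot big_msetDE.
  apply: leq_trans (leq_addr _ _); rewrite -big_filter.
  by rewrite (perm_big (inside s (bset q) pi)) // perm_sym perm_sort.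
by move: pP; rewrite -(mx rho le) er => /tauP[].
Qed.

(** A larger element has the same blocks, as a connected set stays within its component, and then
    the same weights, as comparable multisets of equal size coincide. *)
Lemma comps_maximal pi : (forall p, p \in wblocks pi -> bset p \in comps) -> maximal pi.
Proof.
move=> hC rho le.
have sub p : p \in wblocks pi -> p \in wblocks rho.
  move=> pP; have /set0Pn[v vp] := wblock_neq0 pP.
  have [q qR vq] := wblock_exists rho v.
  have pq := gle_sub le pP qR vp vq.
  have e1 : bset p = bset q.
    apply/eqP; rewrite eqEsubset pq (comps_eq (hC p pP) vp).
    exact: conn_sub_component (gblock_conn qR) vq.
  have e2 : bwt p = bwt q.
    apply: msubset_size_eq; first exact: wpartition_le_block le pP qR pq.
    by rewrite (wblock_size pP) (wblock_size qR) e1.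
  suff -> : p = q by [].
  by move: e1 e2; case: (p) (q) => [? ?] [? ?] /= -> ->.
apply: gpartition_eq => q; apply/idP/idP => [qR|]; last exact: sub.
have /set0Pn[v vq] := wblock_neq0 qR; have [p pP vp] := wblock_exists pi v.
by rewrite (wblock_inj qR (sub p pP) vq vp).
Qed.

Lemma inside_comps pi : maximal pi -> [seq bset p | p <- inside s [set: V] pi] = comps.
Proof.
move=> mx; apply: (irr_sorted_eq (leT := fun D D' => min_rank D' < min_rank D)%N).
- by move=> D2 D1 D3 h1 h2; apply: ltn_trans h2 h1.
- by move=> D; rewrite ltnn.
- by rewrite sorted_map; apply: inside_sorted.
- exact: plist_sorted comps_plist.
- move=> B; apply/mapP/idP => [[p + ->]|BC].
    by rewrite mem_inside => /andP[/(maximal_comps mx)].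
  have /set0Pn[v vB] := comps_neq0 BC; have [p pP vp] := wblock_exists pi v.
  exists p; first by rewrite mem_inside pP subsetT.
  by rewrite (comps_eq BC vB) (comps_eq (maximal_comps mx pP) vp).
Qed.

Lemma insideT pi : perm_eq (inside s [set: V] pi) (wblocks pi).
Proof.
rewrite perm_sort; apply: uniq_perm; rewrite ?filter_uniq ?fset_uniq // => p.
by rewrite mem_filter subsetT.
Qed.

(** The maximal elements of weight [nu] are the distributions of [nu] over the components with the
    prescribed sizes, so the product formula for the Moebius function sums to a coefficient of a
    product of series. *)
Lemma mobius_symE nu : mobius_sym E nu = (\prod_(B <- comps) signed_series E s B) nu.
Proof.
pose M := [set pi : gpartition E | maximal pi /\ weight pi = nu]%classic.
have finM : finite_set M.
  by apply: sub_finite_set (finite_gpartition_weight E nu) => pi [].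
rewrite /mobius_sym -(fsbig_widen M); first last.
- move=> pi [/= mx nM]; case: eqP; rewrite ?mulr0 // => w; by case: nM.
- by move=> pi [].
have memM pi : (pi \in fset_set M) = `[<M pi>].
  by rewrite in_fset_set //; apply/idP/asboolP => [/set_mem|/mem_set].
rewrite fsbig_finite //= -(sum_decomps (signed_series E s)).
pose good (t : seq (wblock V)) := all (fun p => size (bwt p) == #|bset p|.-1) t.
transitivity (\sum_(pi <- fset_set M) \prod_(p <- inside s [set: V] pi) block_mobius E s p).
  apply: eq_big_seq => pi; rewrite memM => /asboolP[_ ->].
  by rewrite eqxx mulr1 (mobiusE symE s_all hpeo) /mobius_prod (perm_big _ (insideT pi)).
rewrite -(big_map (inside s [set: V]) predT (fun t => \prod_(p <- t) block_mobius E s p)).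
transitivity (\sum_(t <- decomps comps nu | good t) \prod_(p <- t) block_mobius E s p); last first.
  rewrite big_mkcond; apply: eq_big_seq => t; case: ifPn => // /allPn[p pt sz].
  rewrite mem_decomps => /andP[/eqP eC _].
  rewrite (big_rem p) //= -[signed_series _ _ _ _]/(block_mobius E s p); have [->|nz] := eqVneq (block_mobius E s p) 0.
    by rewrite mul0r.
  by rewrite (block_mobius_size _ nz) ?eqxx // in sz; apply: comps_neq0; rewrite -eC; apply: map_f.
(* Sorting the blocks maps the maximal elements of weight [nu] bijectively to the [good]
   decompositions. *)
rewrite -[RHS]big_filter; apply: perm_big; apply: uniq_perm.
- rewrite map_inj_in_uniq ?fset_uniq // => pi rho _ _ e.
  apply: gpartition_eq => p.
  by rewrite -(perm_mem (insideT pi)) -(perm_mem (insideT rho)) e.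
- by rewrite filter_uniq ?decomps_uniq.
move=> t; apply/mapP/idP => [[pi + ->]|].
  rewrite memM => /asboolP[mx wpi]; rewrite mem_filter mem_decomps inside_comps // eqxx.
  rewrite /wtot (perm_big _ (insideT pi)) -[X in X == _]/(weight pi) wpi eqxx !andbT.
  by apply/allP => p; rewrite mem_inside => /andP[/wblock_size-> _].
rewrite mem_filter mem_decomps => /and3P[/allP gt /eqP eC /eqP wt].
have ut : uniq t by apply: (map_uniq (f := fun p : wblock V => bset p)); rewrite eC comps_uniq.
have inC p : p \in t -> bset p \in comps by move=> pt; rewrite -eC map_f.
pose tau : {fset wblock V} := [fset p in t]%fset.
have tauE p : (p \in tau) = (p \in t) by rewrite !finmap.inE.
have [||pi epi] := @gpartition_ex V E tau.
- apply: is_wpartition_intro.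
  + by move=> p; rewrite tauE => /inC/comps_neq0.
  + move=> v; have := mem_comps v; rewrite -eC => /mapP[p pt ep].
    by exists p; rewrite ?tauE // -ep inE connect0.
  + move=> p q v; rewrite !tauE => pt qt vp vq.
    apply: (@uniq_map_inj _ _ (fun p : wblock V => bset p) t) => //.
      by rewrite eC comps_uniq.
    by rewrite (comps_eq (inC p pt) vp) (comps_eq (inC q qt) vq).
  + by move=> p; rewrite tauE => /gt/eqP.
- by move=> p; rewrite tauE => /inC/compsP[v ->]; apply: component_conn.
have mempi p : (p \in wblocks pi) = (p \in t) by rewrite epi tauE.
have pt_perm : perm_eq (wblocks pi) t by apply: uniq_perm; rewrite ?fset_uniq.
exists pi.
  rewrite memM; apply/asboolP; split.
    by apply: comps_maximal => p; rewrite mempi => /inC.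
  by rewrite -wt /weight (perm_big _ pt_perm).
apply/esym/slist_eq.
- by rewrite filter_uniq ?fset_uniq.
- by move=> p q; rewrite !mem_filter => /andP[_ pP] /andP[_ qP]; apply: (wblock_min_rank_inj s_all pP qP).
- by have := plist_sorted comps_plist; rewrite -eC sorted_map.
- by move=> p; rewrite mem_filter subsetT mempi.
Qed.

Lemma sum_comps_predn : (\sum_(B <- comps) #|B|.-1 = #|V| - n_comp E V)%N.
Proof.
rewrite sum_predn => [|B /comps_neq0]; last by rewrite card_gt0.
by rewrite (sum_card_plist comps_plist) cardsT size_comps.
Qed.
End Components.

Theorem theorem1p3 (V : finType) (E : rel V)
    (symE : symmetric E) (irrE : irreflexive E) (n k : nat)
    (card_V : #|V| = n) (comp_E : n_comp E V = k) (chordalE : chordal E) :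
  e_positive (n - k)%N (fun nu => (-1) ^+ (n - k)%N * mobius_sym E nu).
Proof.
have [s s_all hpeo] := chordal_peo symE irrE chordalE.
(* The exponent becomes the total of [#|B| - 1] over the components, the degree of the product
   below. *)
rewrite -card_V -comp_E -(sum_comps_predn symE s_all).
set d := (\sum_(B <- _) _)%N.
(* The signs of the components multiply to [(-1) ^+ d], which cancels the given sign. *)
have -> : (fun nu => (-1) ^+ d * mobius_sym E nu) = \prod_(B <- comps E s) block_series E s B.
  apply/funext => nu; rewrite (mobius_symE symE s_all hpeo) prod_signed_series pser_signE.
  by rewrite mulrA -expr2 sqrr_sign mul1r.
apply: econe_positive; apply: (econe_prod (d := fun B : {set V} => #|B|.-1)) => B BC.
by apply: econe_block_series; rewrite card_gt0; apply: comps_neq0 BC.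
Qed.
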